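(* Let $\alpha\in(0,1)$, $a>0$, $T>0$, $y_0\in\mathbb{R}$. Consider the Caputo fractional-delay equation $${}^{C}D^{\alpha}y(t)+a\,y(t-T)=b(t),\qquad y(0)=y_0,\qquad y(t)=0\ \text{ for } t<0,$$ with forcing expansion $$b(t)=\sum_{k=0}^{\infty} b_k\left(\frac{t^\alpha}{\alpha}\right)^k,\qquad b_k\in\mathbb{R},$$ and suppose $y$ is causal, locally absolutely continuous, and of exponential order, so that the classical Laplace transform $\mathcal{L}\{y\}(s)$ exists for $\Re s$ sufficiently large. If the convergence condition $$\left|\frac{a\,e^{-sT}}{s^\alpha}\right|<1$$ holds on the vertical line $\Re s=\sigma$ used for inversion of the Laplace transform, then $$y(t)=\sum_{j=0}^{\lfloor t/T\rfloor}(-a)^j\,\theta(t-jT)\left[y(0)\,\frac{(t-jT)^{\alpha j}}{\Gamma(\alpha j+1)}+\sum_{k=0}^{\infty}\frac{\Gamma(\alpha k+1)}{\alpha^k}\,b_k\,\frac{(t-jT)^{(j+k+1)\alpha}}{\Gamma((j+k+1)\alpha+1)}\right]$$ is the exact solution of the Caputo fractional-delay equation ${}^{C}D^{\alpha}y(t)+a\,y(t-T)=b(t)$ with $y(0)=y_0$ and $y(t)=0$ for $t<0$.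
   Context: The Caputo derivative of order $\alpha\in(0,1)$ is ${}^{C}D^{\alpha}f(t)=\frac{1}{\Gamma(1-\alpha)}\int_0^t (t-\tau)^{-\alpha}f'(\tau)\,d\tau$ for $t>0$. ''Causal'' means $y(t)=0$ for $t<0$; local absolute continuity is on $[0,\infty)$. The forcing $b$ is assumed analytic in the sense that the displayed series represents $b(t)$ for $t\ge0$. $\theta$ is the Heaviside step function ($\theta(x)=1$ for $x\ge0$, $\theta(x)=0$ for $x<0$), $\Gamma$ is the Gamma function, and $x^0=1$ (including $x=0$).
   Formalization: The formula is shown to satisfy the equation at every t>0 except t=T, where it fails if y(0) is nonzero (the term a y(t-T) jumps by a y(0), the Caputo derivative does not); a solution y is required to satisfy the equation only for almost every t>0. *)

(* Defs.v *)
From mathcomp Require Export all_boot all_order all_algebra.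
From mathcomp Require Export all_classical all_reals all_analysis.
From mathcomp Require Export complex.
Export Order.TTheory GRing.Theory Num.Theory numFieldNormedType.Exports.

#[export] Set Implicit Arguments.
#[export] Unset Strict Implicit.
#[export] Unset Printing Implicit Defensive.

Open Scope classical_set_scope.
Open Scope ring_scope.

(* Used only for x > 0, where the integral is finite. *)
Definition Gamma {R : realType} (x : R) : R :=
  \int[lebesgue_measure]_(u in `]0, +oo[) (u `^ (x - 1) * expR (- u)).

(* [derive1 f] and the integral are total.  When f is locally absolutely continuous
   on [0, +oo[, f is derivable at almost every tau and the integrand is
   integrable on [0, t] for almost every t > 0, so the default values play no
   role there. *)
Definition caputo {R : realType} (alpha : R) (f : R -> R) (t : R) : R :=
  (Gamma (1 - alpha))^-1 *
  \int[lebesgue_measure]_(tau in `[0, t]) ((t - tau) `^ (- alpha) * derive1 f tau).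

(* For a locally absolutely continuous y this can be required only almost
   everywhere: at t = T the term a * y (t - T) jumps by a * y 0 while the Caputo
   derivative does not, so the equation fails at t = T unless y 0 = 0. *)
Definition caputo_delay_eq {R : realType} (alpha a T : R) (b y : R -> R)
    (t : R) : Prop :=
  caputo alpha y t + a * y (t - T) = b t.

Definition causal {R : realType} (y : R -> R) : Prop :=
  forall t, t < 0 -> y t = 0.

Definition abs_continuous_on {R : realType} (l r : R) (f : R -> R) : Prop :=
  forall eps : R, 0 < eps -> exists2 delta : R, 0 < delta &
    forall (n : nat) (u v : 'I_n -> R),
      (forall i, [/\ l <= u i, u i <= v i & v i <= r]) ->
      trivIset [set: 'I_n]%classic (fun i => [set` `]u i, v i[]) ->
      \sum_(i < n) (v i - u i) < delta ->
      \sum_(i < n) `|f (v i) - f (u i)| < eps.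

(* Only the values of f on [0, +oo[ matter: a causal function may jump at 0. *)
Definition loc_abs_continuous {R : realType} (f : R -> R) : Prop :=
  forall r, 0 < r -> abs_continuous_on 0 r f.

Definition exponential_order {R : realType} (f : R -> R) : Prop :=
  exists M c t0 : R, forall t, t0 <= t -> `|f t| <= M * expR (c * t).

(* Absolute convergence of the Laplace integral of f on the line Re s = sigma
   (hence on Re s >= sigma), as |exp(- s t)| = exp(- sigma t) there. *)
Definition laplace_exists_on_line {R : realType} (f : R -> R) (sigma : R) :
    Prop :=
  lebesgue_measure.-integrable `[0, +oo[
    (EFin \o (fun t => expR (- sigma * t) * f t)).

Definition cexp {R : realType} (z : R[i]) : R[i] :=
  ((expR (complex.Re z) * cos (complex.Im z)) +i*
   (expR (complex.Re z) * sin (complex.Im z)))%C.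

Definition cmod {R : realType} (z : R[i]) : R :=
  Num.sqrt (complex.Re z ^+ 2 + complex.Im z ^+ 2).

(* Principal argument, in ]- pi, pi]. *)
Definition carg {R : realType} (z : R[i]) : R :=
  if 0 <= complex.Im z then acos (complex.Re z / cmod z)
  else - acos (complex.Re z / cmod z).

Definition clog {R : realType} (z : R[i]) : R[i] := (ln (cmod z) +i* carg z)%C.

(* Principal branch of z ^ p; meaningful for z != 0. *)
Definition cpow {R : realType} (z : R[i]) (p : R) : R[i] := cexp (p%:C%C * clog z).

Definition heaviside {R : realType} (x : R) : R := if 0 <= x then 1 else 0.

Definition forcing_term {R : realType} (alpha : R) (bk : nat -> R) (j : nat)
    (x : R) (k : nat) : R :=
  Gamma (alpha * k%:R + 1) / alpha ^+ k * bk k *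
  (x `^ ((j + k + 1)%:R * alpha) / Gamma ((j + k + 1)%:R * alpha + 1)).

(* [Num.truncn (t / T)] is the floor of t / T for t >= 0; for t < 0 the only
   remaining index j = 0 is killed by the Heaviside factor.  Note 0 `^ 0 = 1. *)
Definition delay_series {R : realType} (alpha a T y0 : R) (bk : nat -> R)
    (t : R) : R :=
  \sum_(0 <= j < (Num.truncn (t / T)).+1)
    (- a) ^+ j * heaviside (t - j%:R * T) *
    (y0 * ((t - j%:R * T) `^ (alpha * j%:R) / Gamma (alpha * j%:R + 1)) +
     limn (series (forcing_term alpha bk j (t - j%:R * T)))).

(* Main.v *)
From HB Require Import structures.
Require Import Defs.
From mathcomp Require Import measurable_realfun charge lebesgue_stieltjes_measure.
From mathcomp Require Import ring lra.

(** Let [rlk p x = x^(p-1) / Gamma p] for [x > 0] and [0] otherwise, so that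
    [rlk p * rlk q = rlk (p + q)] for convolution on the line, fractional
    integration of order [q] is convolution with [rlk q], and the Caputo
    derivative of an absolutely continuous [f] is [rlk (1 - alpha) * f'].

    Existence: the bracket with index [j] of the solution formula is
    [y0 rlk (alpha j + 1) + sum_k c_k rlk ((j + k + 1) alpha + 1)], which is the
    convolution of [rlk 1] with an explicit series of kernels, its density.
    Convolving that density with [rlk (1 - alpha)] instead gives the bracket with
    index [j - 1], or [b] when [j = 0]; summing the translates by [j T] yields the
    equation.  Only nonnegative series are ever integrated termwise, after
    splitting the coefficients into positive and negative parts.

    Uniqueness is by the method of steps: by the fundamental theorem of calculus
    for absolutely continuous functions (total variation, Radon-Nikodym and
    Lebesgue differentiation) the difference [z] of two solutions is the integral
    of some [z'], and [rlk (1 - alpha) * z' = - a z(. - T)] almost everywhere.  If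
    [z = 0] up to time [n T], convolving with [rlk alpha] gives
    [z = rlk 1 * z' = 0] up to time [(n + 1) T]. *)

(** * Null sets and affine changes of variable *)

Section negligible_integral.
Context d (T : measurableType d) (R : realType) (m : {measure set T -> \bar R}).
Local Open Scope ereal_scope.
Import HBNNSimple.

Let ge0_integral_le_off_null (N : set T) (f g : T -> \bar R) :
  measurable N -> m N = 0 -> (forall x, 0 <= f x) -> (forall x, 0 <= g x) ->
  (forall x, ~ N x -> f x = g x) ->
  \int[m]_x f x <= \int[m]_x g x.
Proof.
move=> mN N0 f0 g0 fg; rewrite !ge0_integralTE//.
apply: ge_ereal_sup => _ [h /= hf <-].
pose h' := proj_nnsfun h (measurableC mN).
have hh' : sintegral m h = sintegral m h'.
  rewrite -!integralT_nnsfun; apply: ge0_ae_eq_integral => //.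
  - exact/measurable_EFinP.
  - exact/measurable_EFinP.
  - by move=> x _; rewrite lee_fin.
  - by move=> x _; rewrite lee_fin.
  exists N; split => // x /= /not_implyP[_ hx]; apply: contrapT => Nx; apply: hx.
  by rewrite /h' /= mindicE mem_set//= mulr1.
rewrite hh'; apply: ereal_sup_ubound; exists h' => //= x.
rewrite mindicE; have [Nx|Nx] := pselect (N x).
  by rewrite memNset ?mulr0//=; apply; exact.
by rewrite mem_set//= mulr1 -fg//; exact: hf.
Qed.

(* The integral of a nonnegative function is a supremum over simple functions,
   each of which may be set to 0 on a null set: hence [f] and [g] may be
   nonmeasurable, as [derive1] of an arbitrary function is. *)
Lemma negligible_eq_integral (D : set T) (f g : T -> \bar R) :
  {ae m, forall x, D x -> f x = g x} ->
  \int[m]_(x in D) f x = \int[m]_(x in D) g x.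
Proof.
move=> [N [mN N0 NS]].
rewrite integral_mkcond [RHS]integral_mkcond.
have fg x : ~ N x -> (f \_ D) x = (g \_ D) x.
  move=> Nx; rewrite !patchE; case: ifPn => // /set_mem Dx.
  by apply: contrapT => fgx; apply/Nx/NS => /= /(_ Dx).
rewrite integralE [RHS]integralE; congr (_ - _).
- by apply/eqP; rewrite eq_le; apply/andP; split;
    apply: (ge0_integral_le_off_null mN N0) => // x Nx; rewrite !funeposE fg.
- by apply/eqP; rewrite eq_le; apply/andP; split;
    apply: (ge0_integral_le_off_null mN N0) => // x Nx; rewrite !funenegE fg.
Qed.

End negligible_integral.

Section affine_change.
Context {R : realType}.
Local Open Scope ereal_scope.
Local Notation mu := (@lebesgue_measure R).
Variables (r s : R).
Hypothesis r0 : (r != 0)%R.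

Let phi : measurableTypeR R -> measurableTypeR R := fun x => (s + r * x)%R.

Let mphi : measurable_fun setT phi.
Proof. exact: (@measurable_funD _ R R setT (cst s) ( *%R r)). Qed.

Let image_measure : {measure set (measurableTypeR R) -> \bar R}.
Proof. by refine [the {measure set _ -> \bar R} of pushforward mu phi]. Defined.

(** Lebesgue measure is determined by its values on the intervals []a, b]]. The preimage of one
    under [phi] is an interval of length [(b - a) / |r|], half-open on the other side when
    [r < 0]. *)
Let lebesgue_measure_affine (A : set R) : measurable A ->
  mu A = mscale (NngNum (normr_ge0 r)) image_measure A.
Proof.
move=> mA; apply: lebesgue_measure_unique => //= _ [[a b]] _ <-.
rewrite /mscale/= /pushforward/= /phi.
have [r1|r1] := ltP 0%R r.
  rewrite (_ : _ @^-1` _ = `](a - s) / r, (b - s) / r]%classic)%R; last first.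
    apply/seteqP; split => x /=; rewrite !in_itv/=;
      by rewrite ltr_pdivrMr// ler_pdivlMr// ltrBlDl lerBrDl [(x * r)%R]mulrC.
  rewrite !lebesgue_measure_itv/= !lte_fin ltr_pM2r ?invr_gt0// ltrD2r gtr0_norm//.
  case: ifP => _; last by rewrite mule0.
  by rewrite -!EFinB -EFinM; congr (_%:E); field.
have r2 : (r < 0)%R by rewrite lt_neqAle r0.
rewrite (_ : _ @^-1` _ = `[(b - s) / r, (a - s) / r[%classic)%R; last first.
  apply/seteqP; split => x /=; rewrite !in_itv/=;
    by rewrite ltr_ndivlMr// ler_ndivrMr// ltrBlDl lerBrDl [(x * r)%R]mulrC andbC.
rewrite !lebesgue_measure_itv/= !lte_fin ltr_nM2r ?invr_lt0// ltrD2r ltr0_norm//.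
case: ifP => _; last by rewrite mule0.
by rewrite -!EFinB -EFinM; congr (_%:E); field.
Qed.

Lemma ge0_integral_affine (f : R -> \bar R) :
  measurable_fun setT f -> (forall x, 0 <= f x) ->
  `|r|%:E * \int[mu]_x f (s + r * x)%R = \int[mu]_x f x.
Proof.
move=> mf f0; have -> : \int[mu]_x f (s + r * x)%R = \int[image_measure]_x f x.
  have := ge0_integral_pushforward mphi mu measurableT mf (fun x _ => f0 x).
  by rewrite preimage_setT => ->.
have -> : `|r|%:E = (NngNum (normr_ge0 r))%:num%:E by [].
rewrite -ge0_integral_mscale//.
by apply: eq_measure_integral => //= A mA _; exact/esym/lebesgue_measure_affine.
Qed.

End affine_change.

Section translation.
Context {R : realType}.
Local Open Scope ereal_scope.
Local Notation mu := (@lebesgue_measure R).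
Implicit Types (f : R -> \bar R) (s : R).

Lemma ge0_integral_shift f s : measurable_fun setT f -> (forall x, 0 <= f x) ->
  \int[mu]_x f (x - s)%R = \int[mu]_x f x.
Proof.
move=> mf f0; rewrite -(@ge0_integral_affine _ 1 (- s)%R (oner_neq0 R) f mf f0).
rewrite normr1 mul1e; apply: eq_integral => x _.
by rewrite mul1r addrC.
Qed.

Lemma integral_shift f s : mu.-integrable setT f ->
  mu.-integrable setT (fun x => f (x - s)%R) /\
  \int[mu]_x f (x - s)%R = \int[mu]_x f x.
Proof.
move=> /[dup] fi /integrableP[mf fy].
have mfR : measurable_fun (setT : set R) f := mf.
have mg : measurable_fun (setT : set R) (fun x => f (x - s)%R).
  by apply: (measurableT_comp mfR); exact: measurable_funB.
split.
  apply/integrableP; split => //.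
  rewrite (@ge0_integral_shift (abse \o f))//; first exact: measurableT_comp.
  by move=> x /=; exact: abse_ge0.
rewrite integralE [RHS]integralE; congr (_ - _).
- rewrite -[RHS](ge0_integral_shift s)//; last exact: measurable_funepos.
  by apply: eq_integral => x _; rewrite !funeposE.
- rewrite -[RHS](ge0_integral_shift s)//; last exact: measurable_funeneg.
  by apply: eq_integral => x _; rewrite !funenegE.
Qed.

End translation.

(** * The Gamma function and the Riemann-Liouville kernels *)

Section gamma_function.
Context {R : realType}.
Local Notation mu := (@lebesgue_measure R).
Implicit Types p q u x : R.

Let gintegrand p u : R := u `^ (p - 1) * expR (- u).

Let gintegrand_ge0 p u : 0 <= gintegrand p u.
Proof. by rewrite mulr_ge0 ?powR_ge0 ?expR_ge0. Qed.

Let measurable_gintegrand p (D : set R) : measurable_fun D (gintegrand p).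
Proof.
apply: measurable_funTS; apply: measurable_funM; first exact: measurable_powR.
by apply: measurableT_comp => //; exact: measurableT_comp.
Qed.

Let measurable_Egintegrand p (D : set R) :
  measurable_fun D (fun u => (gintegrand p u)%:E).
Proof. by apply/measurable_EFinP; exact: measurable_gintegrand. Qed.

(** The primitive [x^p / p] bounds the integral over [[1/(n+2), 1]] by [1/p] uniformly in [n], and
    these intervals increase to []0, 1]]. Starting at [n+2] keeps the left end strictly below 1. *)
Lemma integral_powR01_lty p : 0 < p ->
  (\int[mu]_(u in `]0%R, 1%R]) (u `^ (p - 1))%:E < +oo)%E.
Proof.
move=> p0; pose F (n : nat) : set R := `[(n.+2%:R)^-1, 1]%classic.
have n1 n : (n.+2%:R)^-1 < 1 :> R by rewrite invf_lt1 ?ltr1n ?ltr0n.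
have FE : \bigcup_n F n = `]0, 1]%classic.
  apply/seteqP; split => x /=.
    move=> [n _]; rewrite /F /= !in_itv/= => /andP[nx ->]; rewrite andbT.
    by rewrite (lt_le_trans _ nx)// invr_gt0 ltr0n.
  rewrite in_itv/= => /andP[x0 x1]; exists (Num.truncn x^-1) => //.
  rewrite /F /= in_itv/= x1 andbT -[leRHS]invrK lef_pV2 ?posrE ?ltr0n ?invr_gt0//.
  by rewrite (le_trans (ltW (truncnS_gt _)))// ler_nat.
have Fi n : (\int[mu]_(u in F n) (u `^ (p - 1))%:E <= (p^-1)%:E)%E.
  have dp x : 0 < x -> is_derive x 1 (fun x => x `^ p / p) (x `^ (p - 1)).
    move=> x0; have -> : x `^ (p - 1) = p * x `^ (p - 1) * p^-1.
      by rewrite mulrAC divff ?mul1r// lt0r_neq0.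
    rewrite (_ : (fun _ => _) = p^-1 *: ((@powR R)^~ p)); last first.
      by apply/funext => z; rewrite /= mulrC.
    by rewrite mulrC; apply: is_deriveZ; exact: is_derive1_powR.
  have xp x : (n.+2%:R)^-1 <= x -> 0 < x.
    by apply: lt_le_trans; rewrite invr_gt0 ltr0n.
  rewrite (@continuous_FTC2 _ _ (fun x => x `^ p / p))//.
  - rewrite -EFinB lee_fin powR1 mul1r gerBl// divr_ge0 ?powR_ge0// ltW//.
  - apply: continuous_in_subspaceT => x; rewrite inE/= in_itv/= => /andP[nx _].
    apply: differentiable_continuous; apply/derivable1_diffP.
    by apply: derivable_powR; rewrite in_itv/= xp.
  - have cvx x : 0 < x -> {for x, continuous (fun x => x `^ p / p)}.
      move=> x0; apply: differentiable_continuous; apply/derivable1_diffP.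
      by have /@ex_derive := dp _ x0.
    split.
    + move=> x; rewrite in_itv/= => /andP[nx _].
      by have /@ex_derive := dp _ (xp _ (ltW nx)).
    + by apply: cvg_at_right_filter; apply: cvx; exact: xp.
    + by apply: cvg_at_left_filter; apply: cvx; rewrite ltr01.
  - move=> x; rewrite in_itv/= => /andP[nx _].
    by rewrite derive1E; have /@derive_val := dp _ (xp _ (ltW nx)).
have mp (D : set R) : measurable_fun D (fun u => (u `^ (p - 1))%:E).
  by apply: measurable_funTS; apply/measurable_EFinP; exact: measurable_powR.
apply: (@le_lt_trans _ _ (p^-1)%:E); last by rewrite ltry.
rewrite -FE.
have cF : (\int[mu]_(u in F i) (u `^ (p - 1))%:E)%E @[i --> \oo] -->
    (\int[mu]_(u in \bigcup_i F i) (u `^ (p - 1))%:E)%E.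
  apply: ge0_nondecreasing_set_cvg_integral => //.
  - move=> m n mn; apply/subsetPset => x; rewrite /F /= !in_itv/= => /andP[mx ->].
    by rewrite andbT (le_trans _ mx)// lef_pV2 ?posrE ?ltr0n// ler_nat.
  - by move=> i; exact: measurable_itv.
  - by move=> i; exact: mp.
  - by move=> i x _; rewrite lee_fin powR_ge0.
by apply: (cvge_to_le cF); exact: nearW.
Qed.

(** Up to 1 the integrand is at most [u^(p-1)]; beyond 1 it is at most a multiple of the exponential
    density of rate 1/2. *)
Lemma integral_gamma_lty p : 0 < p ->
  (\int[mu]_(u in `]0%R, +oo[) (gintegrand p u)%:E < +oo)%E.
Proof.
move=> p0; pose n := Num.truncn p.
(* Since [exp(u/2) >= (u/2)^(n+1) / (n+1)!] and [p < n + 1], this constant gives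
   [u^(p-1) <= u^(n+1) <= C exp(u/2)] for [u > 1]. *)
pose C : R := (n.+1)`!%:R * 2 ^+ n.+1.
have C0 : 0 <= C by rewrite mulr_ge0 ?exprn_ge0.
have h0 : 0 < 2^-1 :> R by rewrite invr_gt0 ltr0n.
have tail u : 1 < u -> gintegrand p u <= 2 * C * exponential_pdf 2^-1 u.
  move=> u1; have u0 : 0 < u by exact: lt_trans u1.
  rewrite exponential_pdfE ?(ltW u0)//=.
  have -> : 2 * C * (2^-1 * expR (- (2^-1 : R) * u)) = C * expR (- (2^-1 * u)).
    by rewrite mulNr; field.
  have -> : gintegrand p u = u `^ (p - 1) * expR (- (2^-1 * u)) * expR (- (2^-1 * u)).
    by rewrite /gintegrand -mulrA -expRD; congr (_ * expR _); field.
  rewrite ler_wpM2r ?expR_ge0// expRN -ler_pdivlMr ?invr_gt0 ?expR_gt0// invrK.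
  apply: (@le_trans _ _ (u ^+ n.+1)).
    rewrite -powR_mulrn ?(ltW u0)//; apply: ler_powR; first exact: ltW.
    by rewrite lerBlDr (le_trans (ltW (truncnS_gt p)))// lerDl.
  have := @expR_ge1Dxn R (2^-1 * u) n; rewrite mulr_ge0 ?(ltW u0) ?(ltW h0)//.
  move=> /(_ isT) h; apply: (@le_trans _ _ (C * (2^-1 * u) ^+ n.+1 / (n.+1)`!%:R)).
    rewrite /C exprMn exprVn [leRHS](_ : _ = u ^+ n.+1)//.
    field; rewrite expf_neq0 ?pnatr_eq0//= -?natrS ?pnatr_eq0.
    by rewrite -lt0n fact_gt0.
  rewrite -mulrA ler_wpM2l//; apply: le_trans h.
  by rewrite lerDr.
have -> : `]0, +oo[%classic = `]0, 1] `|` `]1, +oo[ :> set R.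
  by rewrite -itv_bndbnd_setU// bnd_simp.
rewrite ge0_integral_setU//=; last 3 first.
- exact: measurable_Egintegrand.
- by move=> x _; rewrite lee_fin.
- rewrite disj_set2E; apply/eqP/seteqP; split => // x [] /=; rewrite !in_itv/=.
  by move=> /andP[_ x1] /andP[+ _]; rewrite ltNge x1.
apply: lte_add_pinfty.
  apply: le_lt_trans (integral_powR01_lty p0); apply: ge0_le_integral => //.
  - by move=> x _; rewrite lee_fin.
  - exact: measurable_Egintegrand.
  - apply: measurable_funTS; apply/measurable_EFinP; exact: measurable_powR.
  - move=> x /=; rewrite in_itv/= => /andP[x0 _].
    by rewrite lee_fin ler_piMr ?powR_ge0// expR_le1 oppr_le0 ltW.
apply: (@le_lt_trans _ _ (\int[mu]_x (2 * C * exponential_pdf 2^-1 x)%:E)%E); last first.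
  under eq_integral do rewrite EFinM.
  rewrite ge0_integralZl//=; last 3 first.
  - by apply/measurable_EFinP; exact: measurable_exponential_pdf.
  - by move=> x _; rewrite lee_fin exponential_pdf_ge0// ltW.
  - by rewrite lee_fin mulr_ge0.
  by rewrite integral_exponential_pdf// mule1 ltry.
rewrite integral_mkcond; apply: ge0_le_integral => //.
- by move=> x _; apply: erestrict_ge0 => y _; rewrite lee_fin.
- by apply/(measurable_restrictT _ _).1 => //; exact: measurable_Egintegrand.
- apply/measurable_EFinP; apply: measurable_funM => //.
  exact: measurable_exponential_pdf.
- move=> x _; rewrite patchE; case: ifPn => [|_].
    by rewrite inE/= in_itv/= andbT => x1; rewrite lee_fin tail.
  by rewrite lee_fin !mulr_ge0// exponential_pdf_ge0// ltW.
Qed.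

Lemma GammaE p : 0 < p ->
  ((Gamma p)%:E = \int[mu]_(u in `]0%R, +oo[) (gintegrand p u)%:E)%E.
Proof.
move=> p0; rewrite /Gamma /Rintegral fineK// ge0_fin_numE ?integral_gamma_lty//.
by apply: integral_ge0 => x _; rewrite lee_fin gintegrand_ge0.
Qed.

(** A zero integral would make the integrand vanish almost everywhere, yet it is positive on all of
    []0, +oo[]. *)
Lemma Gamma_gt0 p : 0 < p -> 0 < Gamma p.
Proof.
move=> p0; rewrite -lte_fin GammaE// lt_neqAle; apply/andP; split; last first.
  by apply: integral_ge0 => x _; rewrite lee_fin.
apply/negP => /eqP g0.
have : (\int[mu]_(u in `]0%R, +oo[) `|(gintegrand p u)%:E|)%E = 0%E.
  rewrite [RHS]g0; apply: eq_integral => x _.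
  by rewrite gee0_abs// lee_fin.
have /= H := ae_eq_integral_abs mu (measurable_itv `]0%R, +oo[)
  (measurable_Egintegrand p (D := _)).
move=> /H [N [mN N0 sN]].
have : (mu `]0%R, +oo[ <= mu N)%E.
  apply: le_measure; rewrite ?inE//.
  move=> x x0; apply: sN => /= /(_ x0) [].
  move: x0; rewrite /= in_itv/= andbT => x0 gx.
  by have : 0 < gintegrand p x; [rewrite mulr_gt0 ?powR_gt0 ?expR_gt0|rewrite gx ltxx].
by rewrite [leRHS]N0 lebesgue_measure_itv/= ltry.
Qed.

Lemma Gamma1 : Gamma 1 = 1 :> R.
Proof.
apply: EFin_inj; rewrite GammaE ?ltr01//.
rewrite integral_itv_obnd_cbnd; last exact: measurable_Egintegrand.
rewrite -(integral_exponential_pdf (ltr01 : 0 < 1 :> R)) integral_mkcond.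
apply: eq_integral => x _; rewrite /exponential_pdf !patchE.
by case: ifPn => // _; rewrite /gintegrand /= subrr powRr0 mulN1r.
Qed.

End gamma_function.

Section rl_kernel.
Context {R : realType}.
Local Notation mu := (@lebesgue_measure R).
Implicit Types p q u x : R.

(* Riemann-Liouville kernel; [rlk 1] is the Heaviside function, up to its value
   at 0. *)
Definition rlk p x : R := if 0 < x then x `^ (p - 1) / Gamma p else 0.

Lemma rlk_ge0 p x : 0 < p -> 0 <= rlk p x.
Proof.
by move=> p0; rewrite /rlk; case: ifP => // _; rewrite divr_ge0 ?powR_ge0 ?ltW ?Gamma_gt0.
Qed.

Lemma rlk_eq0 p x : x <= 0 -> rlk p x = 0.
Proof. by rewrite /rlk leNgt => /negbTE ->. Qed.

Lemma rlkE p x : 0 < x -> rlk p x = x `^ (p - 1) / Gamma p.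
Proof. by rewrite /rlk => ->. Qed.

Lemma rlk1 x : rlk 1 x = (0 < x)%R%:R.
Proof. by rewrite /rlk subrr powRr0 Gamma1 divr1; case: ifP. Qed.

Lemma measurable_rlk p : measurable_fun setT (rlk p).
Proof.
apply: measurable_fun_ifT => //.
- exact: measurable_fun_ltr.
- by apply: measurable_funM => //; exact: measurable_powR.
Qed.

Lemma rlk_dilate p r x : 0 < r -> rlk p (r * x) = r `^ (p - 1) * rlk p x.
Proof.
move=> r0; rewrite /rlk pmulr_rgt0//; case: ifPn => [x0|_]; last by rewrite mulr0.
by rewrite powRM ?ltW// mulrA.
Qed.

(** This is the Laplace transform of the kernel at 1; it fixes the constant in [rlk_conv]. *)
Lemma integral_rlk_expR p : 0 < p -> (\int[mu]_x (rlk p x * expR (- x))%:E = 1)%E.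
Proof.
move=> p0; have G0 := Gamma_gt0 p0.
transitivity ((Gamma p)^-1%:E * (\int[mu]_(u in `]0%R, +oo[) (u `^ (p - 1) * expR (- u))%:E))%E.
  rewrite [X in (_ * X)%E]integral_mkcond -ge0_integralZl//=; last 3 first.
  - apply/(measurable_restrictT _ _).1 => //; apply/measurable_EFinP.
    apply: measurable_funTS; apply: measurable_funM; first exact: measurable_powR.
    by apply: measurableT_comp => //; exact: measurableT_comp.
  - by move=> x _; apply: erestrict_ge0 => y _; rewrite lee_fin mulr_ge0 ?powR_ge0 ?expR_ge0.
  - by rewrite lee_fin invr_ge0 ltW.
  apply: eq_integral => x _; rewrite patchE /rlk; case: ifPn => x0.
    by rewrite mem_set/= ?in_itv/= ?x0// -EFinM; congr (_%:E); ring.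
  by rewrite memNset/= ?in_itv/= ?andbT ?mule0 ?mul0r//; exact/negP.
by rewrite -GammaE// -EFinM mulVf// lt0r_neq0.
Qed.

Let measurable_rlk2 p q : measurable_fun setT
  (fun z : R * R => (rlk q (z.1 - z.2) * rlk p z.2)).
Proof.
apply: measurable_funM; last exact: (measurableT_comp (measurable_rlk p)).
by apply: (measurableT_comp (measurable_rlk q)); exact: measurable_funB.
Qed.

Lemma measurable_rlk_conv p q x :
  measurable_fun setT (fun t : R => (rlk q (x - t) * rlk p t)).
Proof.
apply: measurable_funM; last exact: measurable_rlk.
by apply: (measurableT_comp (measurable_rlk q)); exact: measurable_funB.
Qed.

(* By homogeneity the convolution is [C x^(p+q-1)]; integrating against
   [expR (- x)] identifies [C], without computing a Beta function. *)
Lemma rlk_conv p q x : 0 < p -> 0 < q ->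
  (\int[mu]_t (rlk q (x - t) * rlk p t)%:E = (rlk (p + q) x)%:E)%E.
Proof.
move=> p0 q0; have pq0 : 0 < p + q by rewrite addr_gt0.
pose c y := (\int[mu]_t (rlk q (y - t) * rlk p t)%:E)%E.
have pos y t : 0 <= rlk q (y - t) * rlk p t by rewrite mulr_ge0 ?rlk_ge0.
have c_le0 y : y <= 0 -> c y = 0%E.
  move=> y0; rewrite /c integral0_eq// => t _.
  have [t0|t0] := leP t 0; first by rewrite (rlk_eq0 p t0) mulr0.
  by rewrite rlk_eq0 ?mul0r// subr_le0 (le_trans y0)// ltW.
(* The substitution [t = y u] extracts the factor [y * y^(q-1) * y^(p-1) = y^(p+q-1)]. *)
have cE y : (c y = (Gamma (p + q) * rlk (p + q) y)%:E * c 1%R)%E.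
  have [y0|y0] := leP y 0; first by rewrite c_le0// rlk_eq0// mulr0 mul0e.
  rewrite rlkE// mulrCA divff ?lt0r_neq0 ?Gamma_gt0// mulr1.
  rewrite /c -(@ge0_integral_affine _ y 0 (lt0r_neq0 y0)
    (fun t => (rlk q (y - t) * rlk p t)%:E)); last 2 first.
  - by apply/measurable_EFinP; exact: measurable_rlk_conv.
  - by move=> t; rewrite lee_fin.
  under eq_integral => t _.
    rewrite add0r -{1}[y]mulr1 -mulrBr !rlk_dilate// mulrACA EFinM.
    over.
  rewrite ge0_integralZl//=; last 3 first.
  - by apply/measurable_EFinP; exact: measurable_rlk_conv.
  - by move=> t _; rewrite lee_fin.
  - by rewrite lee_fin mulr_ge0 ?powR_ge0.
  rewrite muleA -EFinM gtr0_norm//; congr ((_)%:E * _)%E.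
  rewrite mulrA mulr_powRB1 ?ltW// -powRD; last by rewrite lt0r_neq0// implybT.
  by congr (_ `^ _); ring.
have c10 : (0 <= c 1%R)%E by apply: integral_ge0 => t _; rewrite lee_fin.
have mexp : measurable_fun (setT : set R) (fun x : R => expR (- x)).
  by apply: measurableT_comp => //; exact: measurableT_comp.
(* By Tonelli and translation, the Laplace transform of the convolution at 1 is the product of those
   of the two kernels, both equal to 1. *)
have I1 : (\int[mu]_y (c y * (expR (- y))%:E) = 1)%E.
  transitivity (\int[mu]_y \int[mu]_t
      (rlk q (y - t) * rlk p t * expR (- y))%:E)%E.
    apply: eq_integral => y _; rewrite /c -ge0_integralZr//=.
    - by apply/measurable_EFinP; exact: measurable_rlk_conv.
    - by move=> t _; rewrite lee_fin.
  rewrite (@fubini_tonelli _ _ _ _ _ mu mu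
    (fun z : R * R => (rlk q (z.1 - z.2) * rlk p z.2 * expR (- z.1))%:E))/=; last 2 first.
  - apply/measurable_EFinP; apply: measurable_funM; first exact: measurable_rlk2.
    exact: (measurableT_comp mexp).
  - by move=> z; rewrite lee_fin mulr_ge0 ?expR_ge0.
  rewrite -(integral_rlk_expR p0); apply: eq_integral => t _.
  transitivity ((rlk p t * expR (- t))%:E *
      \int[mu]_y (rlk q (y - t) * expR (- (y - t)))%:E)%E.
    rewrite -ge0_integralZl//=; last 3 first.
    - apply/measurable_EFinP; apply: measurable_funM.
        by apply: (measurableT_comp (measurable_rlk q)); exact: measurable_funB.
      by apply: (measurableT_comp mexp); exact: measurable_funB.
    - by move=> y _; rewrite lee_fin mulr_ge0 ?rlk_ge0 ?expR_ge0.
    - by rewrite lee_fin mulr_ge0 ?rlk_ge0 ?expR_ge0.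
    apply: eq_integral => y _; rewrite -EFinM; congr (_%:E).
    have -> : expR (- y) = expR (- t) * expR (- (y - t)) by rewrite -expRD; congr expR; ring.
    by move: (rlk q _) (rlk p t) (expR _) (expR _) => A B C D; ring.
  rewrite (@ge0_integral_shift _ (fun y => (rlk q y * expR (- y))%:E)); last 2 first.
  - apply/measurable_EFinP; apply: measurable_funM => //; exact: measurable_rlk.
  - by move=> y; rewrite lee_fin mulr_ge0 ?rlk_ge0 ?expR_ge0.
  by rewrite integral_rlk_expR// mule1.
have G0 := Gamma_gt0 pq0.
have C1 : ((Gamma (p + q))%:E * c 1%R = 1)%E.
  rewrite -I1.
  transitivity (((Gamma (p + q))%:E * c 1%R) *
     \int[mu]_y (rlk (p + q) y * expR (- y))%:E)%E.
    by rewrite integral_rlk_expR// mule1.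
  rewrite -ge0_integralZl//=; last 3 first.
  - apply/measurable_EFinP; apply: measurable_funM => //; exact: measurable_rlk.
  - by move=> y _; rewrite lee_fin mulr_ge0 ?rlk_ge0 ?expR_ge0.
  - by rewrite mule_ge0// lee_fin ltW.
  apply: eq_integral => y _; rewrite [in RHS]cE !EFinM -!muleA.
  by congr (_ * _)%E; rewrite muleCA.
by rewrite -/(c x) cE mulrC EFinM -muleA C1 mule1.
Qed.

End rl_kernel.

(** * Convolution with the kernels *)

Section convolution.
Context {R : realType}.
Local Notation mu := (@lebesgue_measure R).
Implicit Types (q s x : R) (h F : R -> R).

(** Integrability is bundled with the value: the integral is total, and linearity for signed [h]
    holds only for integrable functions. *)
Definition has_conv q h F := forall x,
  mu.-integrable setT (fun t => (rlk q (x - t) * h t)%:E) /\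
  (\int[mu]_t (rlk q (x - t) * h t)%:E = (F x)%:E)%E.

Lemma has_conv_ext q h F G : F =1 G -> has_conv q h F -> has_conv q h G.
Proof. by move=> FG hF x; rewrite -FG; exact: hF. Qed.

Lemma has_convD q h k F G : has_conv q h F -> has_conv q k G ->
  has_conv q (fun t => h t + k t) (fun x => F x + G x).
Proof.
move=> hF kG x; have [hi hE] := hF x; have [ki kE] := kG x.
have E : (fun t => (rlk q (x - t) * (h t + k t))%:E) =
    ((fun t => (rlk q (x - t) * h t)%:E) \+ (fun t => (rlk q (x - t) * k t)%:E))%E.
  by apply/funext => t; rewrite mulrDr EFinD.
rewrite E; split; first exact: integrableD.
by rewrite integralD// hE kE.
Qed.

Lemma has_convZ q c h F : has_conv q h F ->
  has_conv q (fun t => c * h t) (fun x => c * F x).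
Proof.
move=> hF x; have [hi hE] := hF x.
have E : (fun t => (rlk q (x - t) * (c * h t))%:E) =
    (fun t => c%:E * (rlk q (x - t) * h t)%:E)%E.
  by apply/funext => t; rewrite -EFinM mulrCA.
rewrite E; split; first exact: integrableZl.
by rewrite integralZl// hE.
Qed.

Lemma has_conv0 q : has_conv q (fun=> 0) (fun=> 0).
Proof.
move=> x; have E : (fun t => (rlk q (x - t) * 0)%:E) = (fun=> 0%E) :> (R -> \bar R).
  by apply/funext => t; rewrite mulr0.
by rewrite E; split; [exact: integrable0|rewrite integral0].
Qed.

Lemma has_conv_sum q n (h F : nat -> R -> R) :
  (forall j, has_conv q (h j) (F j)) ->
  has_conv q (fun t => \sum_(0 <= j < n) h j t) (fun x => \sum_(0 <= j < n) F j x).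
Proof.
move=> hF; elim: n => [|n IH].
  have -> : (fun t => \sum_(0 <= j < 0) h j t) = (fun=> 0).
    by apply/funext => t; rewrite big_nil.
  by apply: has_conv_ext (has_conv0 q) => x; rewrite big_nil.
have -> : (fun t => \sum_(0 <= j < n.+1) h j t) =
    (fun t => \sum_(0 <= j < n) h j t + h n t).
  by apply/funext => t; rewrite big_nat_recr.
apply: has_conv_ext (has_convD IH (hF n)) => x.
by rewrite big_nat_recr.
Qed.

Lemma has_conv_shift q s h F : has_conv q h F ->
  has_conv q (fun t => h (t - s)) (fun x => F (x - s)).
Proof.
move=> hF x; have [hi hE] := hF (x - s).
have E : (fun t => (rlk q (x - t) * h (t - s))%:E) =
    (fun t => (fun u => (rlk q (x - s - u) * h u)%:E) (t - s)).
  by apply/funext => t /=; congr (_ * _)%:E; congr (rlk q _); ring.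
have [si sE] := integral_shift s hi.
by rewrite E; split => //; rewrite sE.
Qed.

Lemma has_conv_rlk p q : 0 < p -> 0 < q -> has_conv q (rlk p) (rlk (p + q)).
Proof.
move=> p0 q0 x; split; last exact: rlk_conv.
apply/integrableP; split; first by apply/measurable_EFinP; exact: measurable_rlk_conv.
have -> : (\int[mu]_t `|(rlk q (x - t) * rlk p t)%:E| = (rlk (p + q) x)%:E)%E.
  rewrite -rlk_conv//; apply: eq_integral => t _.
  by rewrite gee0_abs// lee_fin mulr_ge0 ?rlk_ge0.
exact: ltry.
Qed.

Lemma measurable_rlk_mul q x h : measurable_fun setT h ->
  measurable_fun setT (fun t : R => rlk q (x - t) * h t).
Proof.
move=> mh; apply: measurable_funM => //.
by apply: (measurableT_comp (measurable_rlk q)); exact: measurable_funB.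
Qed.

End convolution.

(** * Series of kernels and their convolutions *)

Section kernel_series.
Context {R : realType}.
Local Notation mu := (@lebesgue_measure R).
Implicit Types (q s x : R) (c p : nat -> R).

Let measurable_fineT : measurable_fun [set: \bar R] fine.
Proof. exact: fine_measurable. Qed.

(** Taken in the extended reals: with nonnegative coefficients the sum always exists and can be
    integrated termwise before any convergence is known. *)
Definition rlk_eseries c p x : \bar R := (\sum_(0 <= k <oo) (c k * rlk (p k) x)%:E)%E.

Lemma measurable_rlk_eseries c p : (forall k, 0 <= c k) -> (forall k, 0 < p k) ->
  measurable_fun setT (rlk_eseries c p).
Proof.
move=> c0 p0; apply: ge0_emeasurable_sum => [k x _ _|k _].
  by rewrite lee_fin mulr_ge0// rlk_ge0.
by apply/measurable_EFinP; apply: measurable_funM => //; exact: measurable_rlk.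
Qed.

Lemma rlk_eseries_ge0 c p x : (forall k, 0 <= c k) -> (forall k, 0 < p k) ->
  (0 <= rlk_eseries c p x)%E.
Proof.
by move=> c0 p0; apply: nneseries_ge0 => k _ _; rewrite lee_fin mulr_ge0// rlk_ge0.
Qed.

Lemma rlk_eseries_conv c p q x : (forall k, 0 <= c k) -> (forall k, 0 < p k) ->
  0 < q -> (\int[mu]_t ((rlk q (x - t))%:E * rlk_eseries c p t) =
           rlk_eseries c (fun k => p k + q)%R x)%E.
Proof.
move=> c0 p0 q0; have pos k t : 0 <= rlk q (x - t) * rlk (p k) t.
  by rewrite mulr_ge0// rlk_ge0.
transitivity (\int[mu]_t \sum_(0 <= k <oo)
    (c k * (rlk q (x - t) * rlk (p k) t))%:E)%E.
  apply: eq_integral => t _; rewrite -nneseriesZl//; last first.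
    by move=> k _; rewrite lee_fin mulr_ge0// rlk_ge0.
  by apply: eq_eseriesr => k _; rewrite -EFinM mulrCA.
rewrite integral_nneseries//; last 2 first.
- move=> k; apply/measurable_EFinP; apply: measurable_funM => //.
  exact: measurable_rlk_conv.
- by move=> k t _; rewrite lee_fin mulr_ge0.
apply: eq_eseriesr => k _; under eq_integral do rewrite EFinM.
rewrite ge0_integralZl//=; last 3 first.
- by apply/measurable_EFinP; exact: measurable_rlk_conv.
- by move=> t _; rewrite lee_fin.
- by rewrite lee_fin.
by rewrite rlk_conv// -EFinM.
Qed.

Lemma rlk_eseries_fin c p x :
  cvgn (series (fun k => c k * rlk (p k) x)) ->
  rlk_eseries c p x = (limn (series (fun k => c k * rlk (p k) x)))%:E.
Proof.
move=> cv; rewrite -EFin_lim//; congr (limn _); apply/funext => n.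
by rewrite /= /series/= sumEFin.
Qed.

(** Convergence is required of the convolved series only. Its finiteness makes the original series
    finite for almost every [t] with [rlk q (x - t) > 0], so [fine] alters the integrand at most on
    a null set. *)
Lemma has_conv_series_ge0 c p q : (forall k, 0 <= c k) -> (forall k, 0 < p k) ->
  0 < q -> (forall x, cvgn (series (fun k => c k * rlk (p k + q) x))) ->
  has_conv q (fine \o rlk_eseries c p)
    (fun x => limn (series (fun k => c k * rlk (p k + q) x))).
Proof.
move=> c0 p0 q0 cv x; set H := rlk_eseries c p.
have mH : measurable_fun setT H by exact: measurable_rlk_eseries.
have H0 t : (0 <= H t)%E by exact: rlk_eseries_ge0.
have mK : measurable_fun setT (fun t : R => (rlk q (x - t))%:E).
  apply/measurable_EFinP.
  by apply: (measurableT_comp (measurable_rlk q)); exact: measurable_funB.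
have I : (\int[mu]_t ((rlk q (x - t))%:E * H t) =
    (limn (series (fun k => c k * rlk (p k + q) x)))%:E)%E.
  by rewrite rlk_eseries_conv// rlk_eseries_fin.
have mKH : measurable_fun setT (fun t : R => (rlk q (x - t))%:E * H t)%E.
  exact: emeasurable_funM.
have KH0 t : (0 <= (rlk q (x - t))%:E * H t)%E by rewrite mule_ge0// lee_fin rlk_ge0.
have iKH : mu.-integrable setT (fun t : R => (rlk q (x - t))%:E * H t)%E.
  apply/integrableP; split => //.
  by under eq_integral do rewrite gee0_abs//; rewrite I ltry.
have mf : measurable_fun setT (fun t : R => (rlk q (x - t) * (fine \o H) t)%:E).
  by apply/measurable_EFinP; apply: measurable_rlk_mul; exact: (measurableT_comp measurable_fineT mH).
have ae : ae_eq mu setT (fun t : R => (rlk q (x - t))%:E * H t)%E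
    (fun t : R => (rlk q (x - t) * (fine \o H) t)%:E).
  have [N [mN N0 NS]] := integrable_ae measurableT iKH.
  exists N; split => // t /= /not_implyP[_ ht]; apply: NS => /= /(_ Logic.I) fn.
  apply: ht; have [K0|K0] := eqVneq (rlk q (x - t)) 0.
    by rewrite K0 mul0e mul0r.
  have Kp : 0 < rlk q (x - t) by rewrite lt_def K0 rlk_ge0.
  move: fn (H0 t); case: (H t) => [r|+ _|]//=.
  by rewrite gt0_muley ?lte_fin.
split.
  apply: (@le_integrable _ _ R mu setT measurableT _ _ mf _ iKH) => t _; rewrite [leRHS]gee0_abs//.
  rewrite gee0_abs ?lee_fin ?mulr_ge0 ?rlk_ge0 ?fine_ge0// EFinM.
  apply: lee_wpmul2l; first by rewrite lee_fin rlk_ge0.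
  by move: (H0 t); rewrite /=; case: (H t) => [r|_|]//=; exact: leey.
rewrite -I; apply/esym; exact: negligible_eq_integral ae.
Qed.

(** A difference of two nonnegative sums rather than a limit of signed partial sums, so that each
    part is measurable and integrable termwise. Where a part is infinite, [fine] replaces it by
    0. *)
Definition rlk_sum c p x : R :=
  fine (rlk_eseries (fun k => Num.max (c k) 0) p x) -
  fine (rlk_eseries (fun k => Num.max (- c k) 0) p x).

Lemma measurable_rlk_sum c p : (forall k, 0 < p k) ->
  measurable_fun setT (rlk_sum c p).
Proof.
move=> p0; apply: measurable_funB; apply: (measurableT_comp measurable_fineT);
  by apply: measurable_rlk_eseries => // k; rewrite le_max lexx orbT.
Qed.

Lemma rlk_sum_eq0 c p x : x <= 0 -> rlk_sum c p x = 0.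
Proof.
move=> x0; rewrite /rlk_sum /rlk_eseries !eseries0 ?subrr// => k _ _;
  by rewrite rlk_eq0// mulr0.
Qed.

Lemma has_conv_rlk_sum c p q : (forall k, 0 < p k) -> 0 < q ->
  (forall x, cvgn (series (fun k => `|c k| * rlk (p k + q) x))) ->
  has_conv q (rlk_sum c p) (fun x => limn (series (fun k => c k * rlk (p k + q) x))).
Proof.
move=> p0 q0 cv.
have K0 k x : 0 <= rlk (p k + q) x by rewrite rlk_ge0// addr_gt0.
have cvpart (d : nat -> R) : (forall k, 0 <= d k) -> (forall k, d k <= `|c k|) ->
    forall x, cvgn (series (fun k => d k * rlk (p k + q) x)).
  move=> d0 dc x; apply: series_le_cvg (cv x) => k.
  - by rewrite mulr_ge0.
  - by rewrite mulr_ge0.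
  - by rewrite ler_wpM2r.
have m0 (r : R) : 0 <= Num.max r 0 by rewrite le_max lexx orbT.
have mle (r : R) : Num.max r 0 <= `|r| by rewrite ge_max ler_norm normr_ge0.
have cv1 := cvpart _ (fun k => m0 (c k)) (fun k => mle (c k)).
have cv2 : forall x, cvgn (series (fun k => Num.max (- c k) 0 * rlk (p k + q) x)).
  by apply: cvpart => // k; rewrite -normrN mle.
have C1 := has_conv_series_ge0 (fun k => m0 (c k)) p0 q0 cv1.
have C2 := has_conv_series_ge0 (fun k => m0 (- c k)) p0 q0 cv2.
have := has_convD C1 (has_convZ (-1) C2).
have -> : (fun t => (fine \o rlk_eseries (fun k => Num.max (c k) 0) p) t +
    -1 * (fine \o rlk_eseries (fun k => Num.max (- c k) 0) p) t) = rlk_sum c p.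
  by apply/funext => t; rewrite mulN1r.
apply: has_conv_ext => x; rewrite mulN1r -limB//; congr (limn _).
apply/funext => n; rewrite /= /series/= [LHS]/GRing.add/= -sumrB.
apply: eq_bigr => k _; rewrite -mulrBl; congr (_ * _).
have [ck|] := boolP (0 <= c k).
  by rewrite max_l// max_r ?subr0// oppr_le0.
rewrite -ltNge => ck; by rewrite max_r ?ltW// max_l ?sub0r ?opprK// oppr_ge0 ltW.
Qed.

End kernel_series.

(** * Fubini's theorem for iterated fractional integrals *)

Section associativity.
Context {R : realType}.
Local Notation mu := (@lebesgue_measure R).
Variables (p q x : R) (h : R -> R).
Hypotheses (p0 : 0 < p) (q0 : 0 < q) (mh : measurable_fun setT h).
Hypothesis ih : mu.-integrable setT (fun t => (rlk (p + q) (x - t) * h t)%:E).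

Let f (z : R * R) : \bar R := (rlk p (x - z.1) * (rlk q (z.1 - z.2) * h z.2))%:E.

Let mf : measurable_fun setT f.
Proof.
apply/measurable_EFinP; apply: measurable_funM.
  by apply: (measurableT_comp (measurable_rlk p)); exact: measurable_funB.
apply: measurable_funM; last exact: (measurableT_comp mh).
by apply: (measurableT_comp (measurable_rlk q)); exact: measurable_funB.
Qed.

Let conv_shift s :
  (\int[mu]_t (rlk p (x - t) * rlk q (t - s))%:E = (rlk (p + q) (x - s))%:E)%E.
Proof.
rewrite [p + q]addrC -(rlk_conv (x - s) q0 p0).
rewrite -[RHS](@ge0_integral_shift _ _ s); last 2 first.
- by apply/measurable_EFinP; exact: measurable_rlk_conv.
- by move=> t; rewrite lee_fin mulr_ge0 ?rlk_ge0.
apply: eq_integral => t _; congr (_ * _)%:E; congr (rlk p _); ring.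
Qed.

(** Integrating [|f|] in [t] first, the semigroup law of the kernels leaves
    [rlk (p + q) (x - s) * |h s|], which is integrable by [ih]. *)
Let intf : (mu \x mu)%E.-integrable setT f.
Proof.
apply/(integrable21ltyP mu mu mf).
have /integrableP[_] := ih; apply: le_lt_trans.
rewrite (_ : (\int[mu]_s \int[mu]_t `|f (t, s)|)%E =
  (\int[mu]_s `|(rlk (p + q) (x - s) * h s)%:E|)%E)//.
apply: eq_integral => s _.
transitivity (`|h s|%:E * \int[mu]_t (rlk p (x - t) * rlk q (t - s))%:E)%E.
  rewrite -ge0_integralZl//=; last 2 first.
  - apply/measurable_EFinP; apply: measurable_funM.
      by apply: (measurableT_comp (measurable_rlk p)); exact: measurable_funB.
    by apply: (measurableT_comp (measurable_rlk q)); exact: measurable_funB.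
  - by move=> t _; rewrite lee_fin mulr_ge0 ?rlk_ge0.
  apply: eq_integral => t _; rewrite /f/= !normrM (ger0_norm (rlk_ge0 _ p0)) (ger0_norm (rlk_ge0 _ q0)).
  rewrite -EFinM; congr (_%:E).
  by move: (rlk p _) (rlk q _) `|h s| => A B C; ring.
by rewrite (conv_shift s) -EFinM /= normrM [`|rlk _ _|]ger0_norm ?rlk_ge0 ?addr_gt0// mulrC.
Qed.

(** Almost every section of the integrable function [f] is integrable, and for [t < x] the constant
    factor [rlk p (x - t)] is positive and can be divided out. *)
Lemma ae_integrable_rlk :
  {ae mu, forall t, t < x -> mu.-integrable setT (fun s => (rlk q (t - s) * h s)%:E)}.
Proof.
have := ae_integrable1 intf; apply: filterS => t it tx.
have K0 : 0 < rlk p (x - t).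
  by rewrite /rlk subr_gt0 tx divr_gt0 ?powR_gt0 ?subr_gt0 ?Gamma_gt0.
have := integrableZl measurableT (rlk p (x - t))^-1 it.
apply: eq_integrable => // s _; rewrite /f/= -EFinM; congr (_%:E).
by rewrite mulKf// lt0r_neq0.
Qed.

(* Fubini form of [rlk p * (rlk q * h) = rlk (p + q) * h]. *)
Lemma rlk_conv_conv_eq0 :
  {ae mu, forall t, t < x ->
    (\int[mu]_s (rlk q (t - s) * h s)%:E = 0)%E} ->
  (\int[mu]_s (rlk (p + q) (x - s) * h s)%:E = 0)%E.
Proof.
move=> h0.
transitivity (\int[mu]_s \int[mu]_t f (t, s))%E.
  apply: eq_integral => s _; rewrite EFinM -(conv_shift s) muleC.
  rewrite -integralZl//; last first.
    apply/integrableP; split.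
      apply/measurable_EFinP; apply: measurable_funM.
        by apply: (measurableT_comp (measurable_rlk p)); exact: measurable_funB.
      by apply: (measurableT_comp (measurable_rlk q)); exact: measurable_funB.
    under eq_integral do rewrite gee0_abs ?lee_fin ?mulr_ge0 ?rlk_ge0//.
    by rewrite (conv_shift s) ltry.
  apply: eq_integral => t _; rewrite /f/= -EFinM; congr (_%:E).
  by move: (rlk p _) (rlk q _) (h s) => A B C; ring.
rewrite -(Fubini intf) -(integral0 mu setT).
apply: negligible_eq_integral.
move: h0 ae_integrable_rlk.
apply: (@filterS2 _ _ (ae_filter_ringOfSetsType mu)) => t h0 it _.
have [xt|tx] := leP x t.
  rewrite (_ : (fun y => f (t, y)) = cst 0%E) ?integral0//.
  by apply/funext => s; rewrite /f/= rlk_eq0 ?mul0r// subr_le0.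
have := integralZl measurableT (it tx) (rlk p (x - t)).
rewrite (h0 tx) mule0 => <-.
by apply: eq_integral => s _; rewrite /f/= EFinM.
Qed.

End associativity.

(** * Absolutely continuous functions *)

Section indefinite_integral.
Context {R : realType}.
Local Notation mu := (@lebesgue_measure R).
Implicit Types (h F : R -> R).

Lemma abs_continuous_onD l r F G : abs_continuous_on l r F ->
  abs_continuous_on l r G -> abs_continuous_on l r (fun x : R => F x + G x).
Proof.
move=> aF aG e e0; have e20 : 0 < e / 2 by rewrite divr_gt0.
have [d1 d10 H1] := aF _ e20; have [d2 d20 H2] := aG _ e20.
exists (Num.min d1 d2) => [|n u v uv tI sd]; first by rewrite lt_min d10.
move: sd; rewrite lt_min => /andP[sd1 sd2].
have {}H1 := H1 n u v uv tI sd1; have {}H2 := H2 n u v uv tI sd2.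
rewrite [e]splitr; apply: le_lt_trans (ltrD H1 H2).
rewrite -big_split/=; apply: ler_sum => i _.
by rewrite opprD addrACA ler_normD.
Qed.

Lemma abs_continuous_onZ l r c F : abs_continuous_on l r F ->
  abs_continuous_on l r (fun x : R => c * F x).
Proof.
move=> aF e e0; have c0 : 0 < `|c| + 1 by rewrite ltr_wpDl.
have [d d0 H] := aF _ (divr_gt0 e0 c0).
exists d => // n u v uv tI sd; have := H n u v uv tI sd.
rewrite ltr_pdivlMr// mulrC; apply: le_lt_trans.
rewrite mulr_sumr; apply: ler_sum => i _.
by rewrite -mulrBr normrM ler_wpM2r// lerDl.
Qed.

Lemma abs_continuous_on_cst l r c : abs_continuous_on l r (fun _ : R => c).
Proof.
move=> e e0; exists 1 => // n u v _ _ _.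
by rewrite big1// => i _; rewrite subrr normr0.
Qed.

Lemma eq_abs_continuous_on l r F G : (forall x : R, l <= x <= r -> F x = G x) ->
  abs_continuous_on l r F -> abs_continuous_on l r G.
Proof.
move=> FG aF e e0; have [d d0 H] := aF e e0; exists d => // n u v uv tI sd.
rewrite (eq_bigr (fun i => `|F (v i) - F (u i)|)); first exact: H.
move=> i _; have [lu uvi vr] := uv i.
by rewrite !FG// ?lu ?vr ?(le_trans lu uvi)// (le_trans uvi vr).
Qed.

Variable h : R -> R.
Hypothesis mh : measurable_fun setT h.
Hypothesis ih : forall x, mu.-integrable `]-oo, x] (EFin \o h).

Lemma indefinite_integralB u v : u <= v ->
  \int[mu]_(t in `]-oo, v]) h t - \int[mu]_(t in `]-oo, u]) h t =
  \int[mu]_(t in `]u, v]) h t.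
Proof. by move=> uv; rewrite (Rintegral_itvB (ih v))// bnd_simp. Qed.

Lemma locally_integrable_itvNy : locally_integrable setT h.
Proof.
split => //; first exact: openT.
move=> K _ cK; have [M [Mr /(_ (M + 1))]] := compact_bounded cK.
rewrite ltrDl ltr01 => /(_ isT) KM.
have /integrableP[_] := ih (M + 1); apply: le_lt_trans.
have mK : measurable K.
  by apply: closed_measurable; apply: compact_closed => //; exact: Rhausdorff.
apply: ge0_subset_integral => //.
- by apply: measurable_funTS; apply/measurable_EFinP; exact: measurableT_comp.
- by move=> x /KM /=; rewrite in_itv/= => /(le_trans (ler_norm _)).
Qed.

Lemma ae_derivable_indefinite_integral :
  {ae mu, forall x, derivable (fun x : R => \int[mu]_(t in `]-oo, x]) h t) x 1 /\
    (fun x : R => \int[mu]_(t in `]-oo, x]) h t)^`()%classic x = h x}.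
Proof. exact: FTC1Ny ih locally_integrable_itvNy. Qed.

Lemma abs_continuous_indefinite_integral l r :
  abs_continuous_on l r (fun x : R => \int[mu]_(t in `]-oo, x]) h t).
Proof.
(* The cut-off makes the function integrable on the whole line without changing it on the intervals
   considered, all of which end before [r]. The absolute continuity of the integral of [|f|] then
   applies to their union. *)
pose f := h \_ `]-oo, r].
have fi : mu.-integrable setT (EFin \o f).
  by rewrite -restrict_EFin; apply/(integrable_mkcond _ _).1.
move=> e e0; have [d [d0 H]] := integral_normr_continuous fi e0.
exists d => // n u v uv tI sd.
pose F i := `]u i, v i[%classic.
pose A := \big[setU/set0]_(i < n) F i.
have mF i : measurable (F i) by exact: measurable_itv.
have mA : measurable A by exact: bigsetU_measurable.
have tI' : trivIset [set` index_enum 'I_n] F.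
  by apply: sub_trivIset tI => i.
have uI : uniq (index_enum 'I_n) by exact: index_enum_uniq.
have muA : (mu A < d%:E)%E.
  have IF i : (\int[mu]_(x in F i) (cst 1%R x)%:E = (v i - u i)%:E)%E.
    have -> : (\int[mu]_(x in F i) (cst 1%R x)%:E = 1 * mu (F i))%E.
      exact: (integral_cst mu (mF i) 1%E).
    rewrite mul1e /F lebesgue_measure_itv/=.
    have [_ + _] := uv i; rewrite le_eqVlt lte_fin => /predU1P[->|->//].
    by rewrite ltxx subrr.
  have -> : mu A = (\int[mu]_(x in A) (cst 1%R x)%:E)%E.
    by rewrite -[LHS]mul1e; apply/esym; exact: (integral_cst mu mA 1%E).
  have -> := @integral_bigsetU_EFin _ _ R mu _ F (cst 1%R) _ mF uI tI'.
    by under eq_bigr do rewrite IF; rewrite sumEFin lte_fin.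
  by apply/measurable_EFinP; exact: measurable_cst.
have := H A mA muA; apply: le_lt_trans.
have fiA : mu.-integrable A (EFin \o f) by exact: integrableS fi.
have mnf (D : set R) : measurable_fun D (EFin \o (fun x => `|f x|)).
  apply: measurable_funTS; apply/measurable_EFinP; apply: measurableT_comp => //.
  by apply/(measurable_restrictT _ _).1 => //; exact: measurable_funTS.
rewrite -lee_fin.
have nfi (D : set R) : measurable D -> mu.-integrable D (EFin \o (fun x => `|f x|)).
  move=> mD; apply: (@integrableS _ _ _ _ setT) => //.
  exact: (integrable_abse fi).
rewrite /Rintegral fineK; last by apply: integrable_fin_num => //; exact: nfi.
have -> := @integral_bigsetU_EFin _ _ R mu _ F (fun x => `|f x|) _ mF uI tI' (mnf _).
rewrite -sumEFin; apply: lee_sum => i _; have [lu uvi vr] := uv i.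
rewrite indefinite_integralB//.
have hi : mu.-integrable `]u i, v i] (EFin \o h).
  apply: integrableS (ih (v i)) => //.
  by move=> x /=; rewrite !in_itv/= => /andP[].
have mi : measurable (`]u i, v i] : set R) by exact: measurable_itv.
have := @le_normr_Rintegral _ _ R mu _ h mi hi.
rewrite -lee_fin => /le_trans; apply.
rewrite /Rintegral fineK; last first.
  by apply: integrable_fin_num => //; exact: (integrable_abse hi).
rewrite -integral_itv_bndo_bndc; last first.
  apply: measurable_funTS; apply/measurable_EFinP; exact: measurableT_comp.
rewrite le_eqVlt; apply/orP; left; apply/eqP; apply: eq_integral => x.
rewrite inE/= in_itv/= => /andP[ux xv].
by rewrite /f patchE mem_set//= in_itv/= ltW// (lt_le_trans xv).
Qed.

End indefinite_integral.

Section heaviside_convolution.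
Context {R : realType}.
Local Notation mu := (@lebesgue_measure R).
Variables (h F : R -> R).
Hypothesis mh : measurable_fun setT h.
Hypothesis hF : has_conv 1 h F.

Lemma has_conv1_integrable x : mu.-integrable `]-oo, x] (EFin \o h).
Proof.
(* At [x + 1] rather than [x], since [rlk 1] vanishes at 0: the kernel then equals 1 on all of
   []-oo, x]], endpoint included. *)
have [hi _] := hF (x + 1).
have {}hi : mu.-integrable `]-oo, x] (fun t => (rlk 1 (x + 1 - t) * h t)%:E).
  exact: integrableS hi.
apply: eq_integrable hi => // t; rewrite inE/= in_itv/= => tx.
by rewrite rlk1 subr_gt0 ltr_pwDr// mul1r.
Qed.

Lemma has_conv1E x : F x = \int[mu]_(t in `]-oo, x]) h t.
Proof.
have [_ FE] := hF x; apply: EFin_inj; rewrite -FE /Rintegral fineK; last first.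
  by apply: integrable_fin_num => //; exact: has_conv1_integrable.
rewrite -integral_itv_bndo_bndc; last first.
  by apply: measurable_funTS; exact/measurable_EFinP.
rewrite [RHS]integral_mkcond; apply: eq_integral => t _.
rewrite rlk1 subr_gt0 patchE; have [tx|xt] := ltP t x.
  by rewrite mem_set/= ?in_itv//= mul1r.
by rewrite memNset/= ?mul0r// in_itv/= ltNge xt.
Qed.

End heaviside_convolution.

(** * Densities of nondecreasing absolutely continuous functions *)

Lemma lebesgue_stieltjes_itvoc (R : realType) (f : cumulative R R) (a b : R) :
  a <= b -> lebesgue_stieltjes_measure f `]a, b]%classic = (f b - f a)%:E.
Proof.
move=> ab; rewrite /lebesgue_stieltjes_measure/= /measure_extension/=.
by rewrite measurable_mu_extE/= ?wlength_itv_bnd//; exact: is_ocitv.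
Qed.

Section nondecreasing_density.
Context {R : realType}.
Local Notation mu := (@lebesgue_measure R).
Variables (r : R) (g : R -> R).
Hypothesis r0 : 0 < r.
Hypothesis ndg : forall x y : R, 0 <= x -> x <= y -> y <= r -> g x <= g y.
Hypothesis acg : abs_continuous_on 0 r g.

(** Clamping to [[0, r]] extends [g] by constants to a cumulative function on the whole line, from
    which a Stieltjes measure can be built. *)
Let cl (x : R) : R := Num.max 0 (Num.min r x).

Let cl_ge0 x : 0 <= cl x. Proof. by rewrite le_max lexx. Qed.

Let cl_le x : cl x <= r.
Proof. by rewrite ge_max (ltW r0) ge_min lexx. Qed.

Let cl_id (x : R) : 0 <= x <= r -> cl x = x.
Proof. by move=> /andP[x0 xr]; rewrite /cl min_r// max_r. Qed.

Let cl_mono (x y : R) : x <= y -> cl x <= cl y.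
Proof.
move=> xy; rewrite /cl.
case: (leP r x) => rx; case: (leP r y) => ry; rewrite ?(max_r (ltW r0));
  (try case: (leP 0 x) => x0); (try case: (leP 0 y) => y0); first [lra | exact: ltW].
Qed.

Let cl_lip (x y : R) : x <= y -> cl y - cl x <= y - x.
Proof.
move=> xy; rewrite /cl.
case: (leP r x) => rx; case: (leP r y) => ry; rewrite ?(max_r (ltW r0));
  (try case: (leP 0 x) => x0); (try case: (leP 0 y) => y0); first [lra | exact: ltW].
Qed.

Let cl_gt (x t : R) : cl x < t -> t <= r -> x < t.
Proof.
rewrite /cl gt_max gt_min => /andP[_ /orP[rt tr|//]].
by have := lt_le_trans rt tr; rewrite ltxx.
Qed.

Let cl_lt (x t : R) : t < cl x -> 0 <= t -> t < x.
Proof.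
rewrite /cl lt_max lt_min => /orP[t0 t1|/andP[//]].
by have := le_lt_trans t1 t0; rewrite ltxx.
Qed.

Let G (x : R) : R := g (cl x).

Let ndG : nondecreasing G.
Proof. by move=> x y xy; rewrite /G; apply: ndg => //; exact: cl_mono. Qed.

Let G_near (e : R) : 0 < e -> exists2 d : R, 0 < d &
  forall x y : R, x <= y -> y - x < d -> G y - G x < e.
Proof.
move=> e0; have [d d0 H] := acg e0; exists d => // x y xy yx.
have := H 1 (fun=> cl x) (fun=> cl y); rewrite !big_ord1.
have -> : `|g (cl y) - g (cl x)| = G y - G x by rewrite ger0_norm// subr_ge0 ndG.
apply.
- by move=> _; split => //; exact: cl_mono.
- by move=> i j _ _ _; rewrite !ord1.
- exact: le_lt_trans (cl_lip xy) yx.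
Qed.

Let cG : continuous G.
Proof.
move=> x; apply/cvgrPdist_lt => e e0; have [d d0 H] := G_near e0.
near=> y; have xyd : `|x - y| < d.
  by near: y; exact: (@cvgr_dist_lt _ _ _ (nbhs x) _ id).
have [xy|/ltW yx] := leP x y.
  by rewrite distrC ger0_norm ?subr_ge0 ?ndG// H// -(ger0_norm (_ : 0 <= y - x)) ?subr_ge0// distrC.
by rewrite ger0_norm ?subr_ge0 ?ndG// H// -(ger0_norm (_ : 0 <= x - y)) ?subr_ge0.
Unshelve. all: by end_near. Qed.

Let G_mixin := isCumulative.Build R _ R G ndG (right_continuousW cG).
Let Gc : cumulative R R := HB.pack G G_mixin.
Let nu := lebesgue_stieltjes_measure Gc.

Let nu_itvoc a b : a <= b -> nu `]a, b] = (G b - G a)%:E.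
Proof. by move=> ab; rewrite /nu lebesgue_stieltjes_itvoc. Qed.

Let J : set R := `]0, r]%classic.

Let mJ : measurable (J : set (measurableTypeR R)).
Proof. exact: measurable_itv. Qed.

Let nuJ : (nu J < +oo)%E.
Proof. by rewrite nu_itvoc ?ltry// ltW. Qed.

Let nuJf : {finite_measure set (measurableTypeR R) -> \bar R} := mfrestr mJ nuJ.

Let open_itvE (I : set R) : open I -> is_interval I -> I `<=` `]-1, r + 1[ ->
  inf I <= sup I /\ I = `]inf I, sup I[%classic.
Proof.
move=> oI iI Ib.
have lI : has_lbound I by exists (-1) => x /Ib/=; rewrite in_itv/= => /andP[/ltW].
have uI : has_ubound I by exists (r + 1) => x /Ib/=; rewrite in_itv/= => /andP[_ /ltW].
have E : I = `]inf I, sup I[%classic.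
  rewrite -{1}((interior_id I).1 oI) interval_bounded_interior//.
split => //; have [I0|/set0P[x Ix]] := eqVneq I set0.
  by rewrite I0 inf0 sup0.
by apply: (@le_trans _ _ x); [exact: ge_inf|exact: ub_le_sup].
Qed.

(** Absolute continuity of [g] becomes that of its Stieltjes measure. The null set is covered by an
    open set of measure less than [d], which splits into countably many disjoint intervals; any
    finitely many of them, once clamped, have total length less than [d], so their [nu]-masses sum
    to less than [e]. *)
Let nu_null (A : set R) : measurable (A : set (measurableTypeR R)) ->
  mu A = 0%E -> nu (A `&` J) = 0%E.
Proof.
move=> mA A0; set B := A `&` J.
have mB : measurable (B : set (measurableTypeR R)) by exact: measurableI.
have muB : mu B = 0%E by apply: subset_measure0 A0 => //; exact: subIsetl.
apply/eqP; rewrite eq_le measure_ge0 andbT; apply/lee_addgt0Pr => e e0.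
rewrite add0e.
have [d d0 H] := acg e0.
have [|V [oV BV Vd]] := @lebesgue_regularity_outer R B d mB _ d0.
  by rewrite [X in (X < _)%E]muB ltry.
(* Boundedness ensures that each component is the open interval between its [inf] and its [sup]. *)
pose U := V `&` `]-1, r + 1[%classic.
have oU : open U by apply: openI => //; exact: itv_open.
have BU : B `<=` U.
  move=> x Bx; split; first exact: BV.
  move: Bx => [_]; rewrite /J/= !in_itv/= => /andP[x0 xr].
  by rewrite (lt_trans _ x0) ?ltrN10//= (le_lt_trans xr)// ltrDl.
have mU : measurable (U : set (measurableTypeR R)) by exact: open_measurable.
have mV : measurable (V : set (measurableTypeR R)) by exact: open_measurable.
have muU : (mu U < d%:E)%E.
  apply: (@le_lt_trans _ _ (mu (V `\` B))) => //.
  have -> : mu (V `\` B) = mu V.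
    have VB : mu (V `&` B) = 0%E.
      by apply: subset_measure0 muB => //; first exact: measurableI.
    by have := measureDI mu mV mB; rewrite /= VB adde0.
  by apply: le_measure; rewrite ?inE//; exact: subIsetl.
pose I := open_disjoint_itv oU.
have oI i : open (I i) by exact: open_disjoint_itv_open.
have mI i : measurable (I i : set (measurableTypeR R)) by exact: open_measurable.
have tI : trivIset [set: nat] I by exact: open_disjoint_itv_trivIset.
have UI : U = \bigcup_i I i by exact: open_disjoint_itv_bigcup.
have IU i : I i `<=` U by rewrite UI; exact: bigcup_sup.
have IE i : inf (I i) <= sup (I i) /\ I i = `]inf (I i), sup (I i)[%classic.
  apply: open_itvE => //; first exact: open_disjoint_itv_is_interval.
  by move=> x /IU[].
apply: (@le_trans _ _ (nu U)).
  by apply: le_measure; rewrite ?inE.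
rewrite (_ : nu U = (\sum_(0 <= i <oo | i \in [set: nat]) nu (I i))%E); last first.
  apply: etrans (congr1 nu UI) _.
  exact: (measure_bigcup (lebesgue_stieltjes_measure Gc) setT I (fun i _ => mI i) tI).
apply: lime_le; first by apply: is_cvg_nneseries => n _ _; exact: measure_ge0.
apply: nearW => n.
have -> : (\sum_(0 <= i < n | i \in [set: nat]) nu (I i) =
    \sum_(i < n) nu (I i))%E.
  by rewrite big_mkord; apply: eq_bigl => i; rewrite in_setT.
pose u (i : 'I_n) := inf (I i); pose v (i : 'I_n) := sup (I i).
apply: (@le_trans _ _ (\sum_(i < n) (G (v i) - G (u i))%:E)%E).
  apply: lee_sum => i _; rewrite -nu_itvoc; last exact: (IE i).1.
  apply: le_measure; rewrite ?inE//.
  have [_ {1}->] := IE i; apply: subset_itvl; rewrite bnd_simp; exact: lexx.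
rewrite sumEFin lee_fin.
have E : \sum_(i < n) `|g (cl (v i)) - g (cl (u i))| = \sum_(i < n) (G (v i) - G (u i)).
  by apply: eq_bigr => i _; rewrite ger0_norm// subr_ge0; apply: ndG; exact: (IE i).1.
have := H n (cl \o u) (cl \o v); rewrite /= E.
move=> {}H; apply/ltW/H.
- by move=> i; split => //; apply: cl_mono; exact: (IE i).1.
(* A point strictly inside two clamped intervals lies in both original components, so disjointness
   survives clamping. *)
- move=> i j _ _ [x [/=]]; rewrite !in_itv/= => /andP[ux xv] /andP[ux' xv'].
  have xr : x <= r by rewrite (le_trans (ltW xv)).
  have x0 : 0 <= x by rewrite (le_trans _ (ltW ux)).
  apply/val_inj; apply: tI => //; exists x; split.
    by have [_ ->] := IE i; rewrite /= in_itv/= (cl_gt ux)// (cl_lt xv).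
  by have [_ ->] := IE j; rewrite /= in_itv/= (cl_gt ux')// (cl_lt xv').
- rewrite -lte_fin; apply: le_lt_trans muU.
  apply: (@le_trans _ _ (\sum_(0 <= i < n) mu (I i))%E); last first.
    rewrite (_ : mu U = (\sum_(0 <= i <oo | i \in [set: nat]) mu (I i))%E); last first.
      apply: etrans (congr1 mu UI) _.
      exact: (measure_bigcup (@lebesgue_measure R) setT I (fun i _ => mI i) tI).
    rewrite (@eq_eseriesl _ _ xpredT); last by move=> i; rewrite in_setT.
    by apply: nneseries_lim_ge => i _ _; exact: measure_ge0.
  rewrite big_mkord -sumEFin; apply: lee_sum => i _.
  have [uv ->] := IE i; rewrite lebesgue_measure_itv/= lte_fin -/(u i) -/(v i).
  case: ltP => [_|vu]; first by rewrite -EFinB lee_fin; exact: cl_lip.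
  have -> : v i = u i by apply/eqP; rewrite eq_le vu; exact: uv.
  by rewrite subrr.
Qed.

(** The function [h] is the Radon-Nikodym density of the Stieltjes measure of [g] restricted to []0,
    r]], whose mass on []0, x]] is [g x - g 0]. *)
Lemma nondecreasing_density : exists h : R -> R,
  [/\ measurable_fun setT h, mu.-integrable setT (EFin \o h),
      (forall t : R, ~~ (0 < t <= r) -> h t = 0) &
      (forall x : R, 0 <= x <= r -> g x = g 0 + \int[mu]_(t in `]-oo, x]) h t)].
Proof.
have dom : nuJf `<< mu.
  by apply/null_content_dominatesP => A mA A0; exact: nu_null.
have [f [f0 ffin fi nuE]] := @radon_nikodym_sigma_finite _ _ R mu nuJf dom.
pose h := (fine \o f) \_ J.
have fiE : EFin \o h = f \_ J.
  apply/funext => t; rewrite /h /= !patchE; case: ifPn => // _.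
  by rewrite /= fineK.
have mfJ : measurable_fun setT (f \_ J).
  apply/(measurable_restrictT _ _).1 => //; apply: measurable_funTS.
  exact: measurable_int fi.
have hi : mu.-integrable setT (EFin \o h).
  rewrite fiE; apply/(integrable_mkcond _ _).1 => //.
  exact: integrableS fi.
exists h; split => //.
- by apply/measurable_EFinP; rewrite fiE.
- by move=> t tr; rewrite /h patchE memNset// /J/= in_itv/=; exact/negP.
move=> x xr; have /andP[x0 xr'] := xr.
apply/eqP; rewrite addrC -subr_eq; apply/eqP; apply: EFin_inj.
rewrite /Rintegral fineK; last first.
  by apply: integrable_fin_num => //; exact: integrableS hi.
transitivity (nuJf `]0, x]%classic).
  rewrite /nuJf/= /mfrestr /mrestr setIidl; last first.
    by apply: subset_itvl; rewrite bnd_simp.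
  by rewrite lebesgue_stieltjes_itvoc//= /G !cl_id// lexx ltW.
rewrite nuE; last exact: measurable_itv.
rewrite -[RHS](_ : (\int[mu]_(t in `]-oo, x]) (f \_ J) t = _)%E); last by rewrite -fiE.
rewrite -integral_mkcondr; congr (integral _ _ _).
apply/seteqP; split => t; rewrite /J/= !in_itv/=.
  by move=> /andP[t0 tx]; split => //; rewrite t0 (le_trans tx).
by move=> [tx /andP[->]].
Qed.

End nondecreasing_density.

Lemma near_eq_derive1_addr (R : realType) (f g : R -> R) (x c : R) :
  {near x, g \+ cst c =1 f} -> derivable g x 1 ->
  derivable f x 1 /\ f^`()%classic x = g^`()%classic x.
Proof.
move=> gf dg; have [dgc E] : is_derive x 1 (g \+ cst c) ('D_1 g x + 0).
  by apply: is_deriveD; exact: derivableP.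
split; first exact: near_eq_derivable gf dgc.
by rewrite !derive1E -(near_eq_derive _ gf) E addr0.
Qed.

(** * Total variation of absolutely continuous functions *)

Section abs_continuous_variation.
Context {R : realType}.
Implicit Types (l r : R) (f : R -> R).

(** An arbitrary finite index type allows families indexed by dependent pairs, as needed for the
    cells of several partitions at once. *)
Lemma abs_continuous_on_finType l r f : abs_continuous_on l r f ->
  forall e : R, 0 < e -> exists2 d : R, 0 < d &
  forall (J : finType) (u v : J -> R),
    (forall j, [/\ l <= u j, u j <= v j & v j <= r]) ->
    (forall i j x, u i < x < v i -> u j < x < v j -> i = j) ->
    \sum_j (v j - u j) < d -> \sum_j `|f (v j) - f (u j)| < e.
Proof.
move=> acf e e0; have [d d0 H] := acf e e0; exists d => // J u v uv tI.
rewrite [X in X < _](eq_bigl (mem J))// big_enum_val => sd.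
rewrite (eq_bigl (mem J))// big_enum_val.
apply: (H _ (u \o enum_val) (v \o enum_val)) => //; first by move=> i; exact: uv.
move=> i j _ _ [x [/=]].
rewrite !in_itv/= => xi xj; apply: enum_val_inj; exact: tI xi xj.
Qed.

Section partitions.
Variables (l r e d : R) (f : R -> R).
Hypothesis Hd : forall (J : finType) (u v : J -> R),
    (forall j, [/\ l <= u j, u j <= v j & v j <= r]) ->
    (forall i j x, u i < x < v i -> u j < x < v j -> i = j) ->
    \sum_j (v j - u j) < d -> \sum_j `|f (v j) - f (u j)| < e.

(** Subdividing preserves the total length, so [Hd] applies to the family of all cells of all the
    partitions, whose increments add up to the variations. *)
Let sum_variation n (u v : 'I_n -> R) (s : 'I_n -> seq R) :
  (forall i, [/\ l <= u i, u i <= v i & v i <= r]) ->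
  (forall i j x, u i < x < v i -> u j < x < v j -> i = j) ->
  (forall i, itv_partition (u i) (v i) (s i)) ->
  \sum_i (v i - u i) < d ->
  \sum_i variation (u i) (v i) f (s i) < e.
Proof.
move=> uv tI ps sd.
pose J := {i : 'I_n & 'I_(size (s i))}.
pose pt i k := nth (v i) (u i :: s i) k.
pose u' (j : J) := pt (tag j) (tagged j); pose v' (j : J) := pt (tag j) (tagged j).+1.
have ptS i (k : nat) : (k < size (s i))%N -> pt i k < pt i k.+1.
  move=> ks; have [+ _] := ps i => /(pathP (v i)) /(_ k ks).
  by rewrite /pt.
have pt_mono i (k m : nat) : (k <= m)%N -> (m <= size (s i))%N -> pt i k <= pt i m.
  elim: m => [|m IH]; first by rewrite leqn0 => /eqP ->.
  rewrite leq_eqVlt => /predU1P[->//|km ms].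
  by rewrite (le_trans (IH km (ltnW ms)))// ltW// ptS.
have pt_ge i (k : nat) : (k <= size (s i))%N -> u i <= pt i k.
  by move=> ks; apply: itv_partition_nth_ge => //; rewrite ltnS.
have pt_le i (k : nat) : (k <= size (s i))%N -> pt i k <= v i.
  by move=> ks; apply: itv_partition_nth_le => //; rewrite ltnS.
have sumJ (F : forall i : 'I_n, 'I_(size (s i)) -> R) :
    \sum_(j : J) F (tag j) (tagged j) = \sum_i \sum_(k < size (s i)) F i k.
  rewrite (@sig_big_dep _ _ _ _ (fun i => 'I_(size (s i))) xpredT (fun _ => xpredT) F).
  exact: eq_bigl.
have varE : \sum_(j : J) `|f (v' j) - f (u' j)| = \sum_i variation (u i) (v i) f (s i).
  rewrite (sumJ (fun i k => `|f (pt i k.+1) - f (pt i k)|)).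
  by apply: eq_bigr => i _; rewrite /variation big_mkord.
have lenE : \sum_(j : J) (v' j - u' j) = \sum_i (v i - u i).
  rewrite (sumJ (fun i k => pt i k.+1 - pt i k)); apply: eq_bigr => i _.
  rewrite -(big_mkord xpredT (fun k => pt i k.+1 - pt i k)) telescope_sumr//.
  by rewrite /pt (itv_partition_nth_size _ (ps i)).
rewrite -varE; apply: Hd; last by rewrite lenE.
- move=> [i k]; rewrite /u' /v'/=; have [lu _ vr] := uv i; split.
  + by rewrite (le_trans lu)// pt_ge// ltnW.
  + by rewrite ltW// ptS.
  + by rewrite (le_trans _ vr)// pt_le.
- move=> [i k] [j m] x; rewrite /u' /v'/= => /andP[ix xi] /andP[jx xj].
  have ij : i = j.
    apply: (tI i j x); apply/andP; split.
    + by rewrite (le_lt_trans _ ix)// pt_ge// ltnW.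
    + by rewrite (lt_le_trans xi)// pt_le.
    + by rewrite (le_lt_trans _ jx)// pt_ge// ltnW.
    + by rewrite (lt_le_trans xj)// pt_le.
  subst j; congr existT; apply/val_inj => /=.
  apply/eqP; rewrite eqn_leq; apply/andP; split; rewrite leqNgt; apply/negP => km.
  + have := lt_le_trans xj (pt_mono i m.+1 k km (ltnW (ltn_ord k))).
    by rewrite ltNge (ltW ix).
  + have := lt_le_trans xi (pt_mono i k.+1 m km (ltnW (ltn_ord m))).
    by rewrite ltNge (ltW jx).
Qed.

Lemma total_variation_lt u v : l <= u -> u <= v -> v <= r -> v - u < d ->
  (total_variation u v f <= e%:E)%E.
Proof.
move=> lu uv vr vud; apply: ge_ereal_sup => _ [_ [s ps <-] <-].
have := @sum_variation 1 (fun=> u) (fun=> v) (fun=> s); rewrite !big_ord1.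
rewrite lee_fin => H; apply/ltW/H => //.
by move=> i j; rewrite !ord1.
Qed.

Lemma sum_total_variation n (u v : 'I_n -> R) :
  (forall i, [/\ l <= u i, u i <= v i & v i <= r]) ->
  (forall i j x, u i < x < v i -> u j < x < v j -> i = j) ->
  \sum_i (v i - u i) < d ->
  \sum_i fine (total_variation (u i) (v i) f) <= e.
Proof.
move=> uv tI sd.
have TVfin i : total_variation (u i) (v i) f \is a fin_num.
  have [lu uvi vr] := uv i.
  rewrite ge0_fin_numE ?total_variation_ge0//.
  apply: le_lt_trans (ltry e); apply: total_variation_lt => //.
  apply: le_lt_trans sd; rewrite (bigD1 i)//= lerDl sumr_ge0// => j _.
  by have [_ ? _] := uv j; rewrite subr_ge0.
apply/ler_addgt0Pr => eps eps0.
(* Each of the [n] total variations is approximated within this error, for a total of at most [eps];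
   [n.+1] avoids a division by 0. *)
have eta0 : 0 < eps / n.+1%:R by rewrite divr_gt0.
have /choice[s Hs] i : exists s, itv_partition (u i) (v i) s /\
    fine (total_variation (u i) (v i) f) <= variation (u i) (v i) f s + eps / n.+1%:R.
  have [_ [x [s ps <-] <-]] := ub_ereal_sup_adherent eta0 (TVfin i).
  rewrite -/(total_variation (u i) (v i) f) -{1}(fineK (TVfin i)) -EFinB lte_fin => H.
  by exists s; split => //; rewrite ltW// -ltrBlDr.
have H := @sum_variation n u v s uv tI (fun i => (Hs i).1) sd.
apply: (@le_trans _ _ (\sum_i (variation (u i) (v i) f (s i) + eps / n.+1%:R))).
  by apply: ler_sum => i _; exact: (Hs i).2.
rewrite big_split/= lerD ?(ltW H)// sumr_const card_ord -[leLHS]mulr_natr -mulrA.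
by rewrite ler_piMr ?(ltW eps0)// mulrC ler_pdivrMr ?ltr0n// mul1r ler_nat.
Qed.

End partitions.

Variables (r : R) (f : R -> R).
Hypothesis r0 : 0 < r.
Hypothesis acf : abs_continuous_on 0 r f.

(** Cut into [N] pieces shorter than the [d] that belongs to [e = 1], the interval has variation at
    most 1 on each piece, and total variation is additive. *)
Lemma abs_continuous_total_variation_fin : total_variation 0 r f \is a fin_num.
Proof.
have [d d0 Hd] := abs_continuous_on_finType acf ltr01.
pose N := (Num.truncn (r / d)).+1.
have N0 : 0 < N%:R :> R by rewrite ltr0n.
have rN : r / N%:R < d by rewrite ltr_pdivrMr// mulrC -ltr_pdivrMr// truncnS_gt.
pose x (k : nat) := k%:R * (r / N%:R).
have rN0 : 0 < r / N%:R by rewrite divr_gt0.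
have x0 k : 0 <= x k by rewrite mulr_ge0// ltW.
have xS k : x k <= x k.+1 by rewrite ler_wpM2r ?ler_nat// ltW.
have xN : x N = r by rewrite /x mulrCA divff ?mulr1// lt0r_neq0.
rewrite -xN.
have : (N <= N)%N by [].
elim: {1 3}N => [_|k IH kN]; first by rewrite /x mul0r total_variationxx.
rewrite (@total_variationD _ 0 _ (x k))// fin_numD IH ?(ltnW kN)//=.
rewrite ge0_fin_numE ?total_variation_ge0//.
apply: le_lt_trans (ltry 1); apply: (total_variation_lt Hd) => //.
  by rewrite -xN ler_wpM2r ?ler_nat// ltW.
by rewrite /x -mulrBl -natr1 addrAC subrr add0r mul1r.
Qed.

Let V x := fine (total_variation 0 x f).

Let TVfin u v : 0 <= u -> u <= v -> v <= r -> total_variation u v f \is a fin_num.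
Proof.
move=> u0 uv vr; have := abs_continuous_total_variation_fin.
have v0 := le_trans u0 uv.
rewrite (@total_variationD _ 0 r v)// fin_numD => /andP[+ _].
by rewrite (@total_variationD _ 0 v u)// fin_numD => /andP[].
Qed.

Let VB u v : 0 <= u -> u <= v -> v <= r -> V v - V u = fine (total_variation u v f).
Proof.
move=> u0 uv vr; rewrite /V (@total_variationD _ 0 v u)// fineD ?TVfin//.
  by rewrite addrAC subrr add0r.
exact: le_trans vr.
Qed.

Lemma abs_continuous_total_variation : abs_continuous_on 0 r V.
Proof.
(* Passing to suprema over partitions leaves only a weak inequality, so half of [e] is used to
   regain a strict one. *)
move=> e e0; have e20 : 0 < e / 2 by rewrite divr_gt0.
have [d d0 Hd] := abs_continuous_on_finType acf e20.
exists d => // n u v uv tI sd.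
rewrite (eq_bigr (fun i => fine (total_variation (u i) (v i) f))); last first.
  move=> i _; have [u0 uvi vr] := uv i.
  by rewrite VB// ger0_norm// fine_ge0// total_variation_ge0.
apply: (@le_lt_trans _ _ (e / 2)); last by rewrite ltr_pdivrMr// ltr_pMr// ltr1n.
apply: (sum_total_variation Hd) => // i j x xi xj.
by apply: tI => //; exists x; split; rewrite /= in_itv.
Qed.

Local Notation mu := (@lebesgue_measure R).

(* [f = V - (V - f)] with [V] the total variation: a difference of two
   nondecreasing absolutely continuous functions. *)
Lemma abs_continuous_density : exists h : R -> R,
  [/\ measurable_fun setT h, mu.-integrable setT (EFin \o h),
      (forall t : R, ~~ (0 < t <= r) -> h t = 0),
      (forall x : R, 0 <= x <= r -> f x = f 0 + \int[mu]_(t in `]-oo, x]) h t) &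
      {ae mu, forall x, 0 < x < r -> derivable f x 1 /\ f^`()%classic x = h x}].
Proof.
have ndV (x y : R) : 0 <= x -> x <= y -> y <= r -> V x <= V y.
  by move=> x0 xy yr; rewrite -subr_ge0 VB// fine_ge0// total_variation_ge0.
pose W x := V x + -1 * f x.
have acW : abs_continuous_on 0 r W.
  exact: abs_continuous_onD abs_continuous_total_variation (abs_continuous_onZ _ acf).
have ndW (x y : R) : 0 <= x -> x <= y -> y <= r -> W x <= W y.
  move=> x0 xy yr; have h1 : f y - f x <= V y - V x.
    rewrite VB// (le_trans (ler_norm _))// -lee_fin fineK ?TVfin//.
    exact: total_variation_ge.
  by rewrite /W; lra.
have [h1 [mh1 ih1 z1 E1]] := nondecreasing_density r0 ndV abs_continuous_total_variation.
have [h2 [mh2 ih2 z2 E2]] := nondecreasing_density r0 ndW acW.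
pose h x := h1 x - h2 x.
have mh : measurable_fun setT h by exact: measurable_funB.
have ih : mu.-integrable setT (EFin \o h).
  rewrite (_ : EFin \o h = ((EFin \o h1) \- (EFin \o h2))%E); last by apply/funext => t; rewrite /h/= EFinB.
  exact: integrableB.
have fE (x : R) : 0 <= x <= r -> f x = f 0 + \int[mu]_(t in `]-oo, x]) h t.
  move=> xr; rewrite RintegralB//; last 2 first.
  - exact: integrableS ih1.
  - exact: integrableS ih2.
  have := E1 _ xr; have := E2 _ xr; rewrite /W; lra.
exists h; split => //.
  by move=> t tr; rewrite /h z1// z2// subrr.
have ih' (x : R) : mu.-integrable `]-oo, x] (EFin \o h) by exact: integrableS ih.
have := ae_derivable_indefinite_integral mh ih'.
apply: (@filterS _ _ (ae_filter_ringOfSetsType mu)) => x [dH HE] /andP[x0 xr].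
pose H y := \int[mu]_(t in `]-oo, y]) h t.
have nearE : {near x, H \+ cst (f 0) =1 f}.
  have : x \in `]0, r[ by rewrite in_itv/= x0 xr.
  move=> /near_in_itvoo; apply: filterS => y; rewrite in_itv/= => /andP[y0 yr].
  by rewrite /= addrC [RHS](fE y)// !ltW.
have [df fH] := near_eq_derive1_addr nearE dH.
by split => //; rewrite fH.
Qed.

End abs_continuous_variation.

(** * The delay equation *)

Section caputo_convolution.
Context {R : realType}.
Local Notation mu := (@lebesgue_measure R).

Lemma has_conv1_indefinite_integral (h : R -> R) : measurable_fun setT h ->
  (forall x : R, mu.-integrable `]-oo, x] (EFin \o h)) ->
  has_conv 1 h (fun x : R => \int[mu]_(t in `]-oo, x]) h t).
Proof.
move=> mh ih x.
have E : (fun t => (rlk 1 (x - t) * h t)%:E) = (EFin \o h) \_ `]-oo, x[.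
  apply/funext => t; rewrite rlk1 subr_gt0 patchE; have [tx|xt] := ltP t x.
    by rewrite mem_set/= ?in_itv//= mul1r.
  by rewrite memNset/= ?mul0r// in_itv/= ltNge xt.
rewrite E; split.
  apply/(integrable_mkcond _ _).1 => //; apply: integrableS (ih x) => //.
  by apply: subset_itvl; rewrite bnd_simp.
rewrite -integral_mkcond integral_itv_bndo_bndc; last first.
  by apply: measurable_funTS; exact/measurable_EFinP.
by rewrite /Rintegral fineK//; apply: integrable_fin_num => //; exact: ih.
Qed.

Lemma ae_neq (c : R) : {ae mu, forall x, x != c}.
Proof.
exists [set c]; split => //; first exact: lebesgue_measure_set1.
by move=> x /= /negP; rewrite negbK => /eqP.
Qed.

(** The factor [(t - s)^(-alpha) / Gamma (1 - alpha)] is [rlk (1 - alpha) (t - s)], and the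
    derivative may be replaced by an almost everywhere equal density. By [ih] the integral is
    finite, so the real-valued integral in [caputo] is not a default value. *)
Lemma caputoE (alpha : R) (f h : R -> R) (t : R) : 0 < alpha < 1 -> 0 < t ->
  (forall u, u <= 0 -> h u = 0) ->
  {ae mu, forall x, 0 < x < t -> f^`()%classic x = h x} ->
  mu.-integrable setT (fun s => (rlk (1 - alpha) (t - s) * h s)%:E) ->
  ((caputo alpha f t)%:E = \int[mu]_s (rlk (1 - alpha) (t - s) * h s)%:E)%E.
Proof.
move=> /andP[a0 a1] t0 h0 fh ih.
have G0 : 0 < Gamma (1 - alpha) by rewrite Gamma_gt0// subr_gt0.
have E : (\int[mu]_(s in `[0%R, t]) ((t - s) `^ (- alpha) * f^`()%classic s)%:E =
    (Gamma (1 - alpha))%:E * \int[mu]_s (rlk (1 - alpha) (t - s) * h s)%:E)%E.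
  rewrite -integralZl// [LHS]integral_mkcond; apply: negligible_eq_integral.
  (* The endpoints lie in the domain of integration, but [fh] says nothing there; they are discarded
     as null sets. *)
  move: fh (ae_neq 0) (ae_neq t).
  apply: (@filterS3 _ _ (ae_filter_ringOfSetsType mu)) => s fh s0 st _.
  rewrite patchE -EFinM; have [sneg|spos|s0'] := ltgtP s 0; last 2 first.
  - have [slt|sgt|ste] := ltgtP s t; last by rewrite ste eqxx in st.
    + rewrite mem_set/= ?in_itv/= ?(ltW spos) ?(ltW slt)// fh ?spos//.
      congr (_%:E); rewrite rlkE ?subr_gt0// (_ : 1 - alpha - 1 = - alpha); last by ring.
      by field; exact: lt0r_neq0.
    + rewrite memNset/= ?in_itv/= ?(lt_geF sgt) ?andbF//.
      by rewrite rlk_eq0 ?mul0r ?mulr0// subr_le0 ltW.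
  - by rewrite s0' eqxx in s0.
  rewrite memNset/= ?in_itv/= ?(lt_geF sneg)//.
  by rewrite h0 ?mulr0// ltW.
have fin : (\int[mu]_s (rlk (1 - alpha) (t - s) * h s)%:E)%E \is a fin_num.
  exact: integrable_fin_num.
rewrite /caputo /Rintegral E -(fineK fin) -EFinM/= mulrA mulVf ?mul1r//.
exact: lt0r_neq0.
Qed.

End caputo_convolution.

(** * Coefficients of the forcing and convergence of its fractional integrals *)

Section coefficients.
Context {R : realType}.
Local Notation mu := (@lebesgue_measure R).
Variables (alpha : R) (bk : nat -> R) (b : R -> R).
Hypothesis halpha : 0 < alpha < 1.
Hypothesis hb : forall t : R, 0 <= t ->
  series (fun k : nat => bk k * (t `^ alpha / alpha) ^+ k) @ \oo --> b t.

Let alpha0 : 0 < alpha. Proof. by case/andP: halpha. Qed.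

(** Coefficients of [b] when it is expanded in the kernels [rlk (alpha * k + 1)] instead of
    powers. *)
Definition forcing_coef k : R := Gamma (alpha * k%:R + 1) / alpha ^+ k * bk k.

Let p1_gt0 (k : nat) : 0 < alpha * k%:R + 1.
Proof. by rewrite ltr_wpDl// mulr_ge0// ltW. Qed.

(** Both sides are convolutions with [rlk q], and [rlk (p + 1) t <= rlk (p + 1) x] for [0 < t < x].
    Raising the exponent by [q] thus costs a factor independent of [p]. *)
Lemma rlk_addr_le (p q x : R) : 0 <= p -> 0 < q -> 0 < x ->
  rlk (p + 1 + q) x <= rlk (p + 1) x * rlk (1 + q) x.
Proof.
move=> p0 q0 x0; have p10 : 0 < p + 1 by rewrite ltr_wpDl.
suff : (\int[mu]_t (rlk q (x - t) * rlk (p + 1) t)%:E <=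
    (rlk (p + 1) x)%:E * \int[mu]_t (rlk q (x - t) * rlk 1 t)%:E)%E.
  by rewrite (rlk_conv x p10 q0) (rlk_conv x ltr01 q0) -EFinM lee_fin.
rewrite -ge0_integralZl//=; last 3 first.
- by apply/measurable_EFinP; exact: measurable_rlk_conv.
- by move=> t _; rewrite lee_fin mulr_ge0 ?rlk_ge0.
- by rewrite lee_fin rlk_ge0.
apply: ge0_le_integral => //.
- by move=> t _; rewrite lee_fin mulr_ge0 ?rlk_ge0.
- by apply/measurable_EFinP; exact: measurable_rlk_conv.
- apply/measurable_EFinP; apply: measurable_funM => //; exact: measurable_rlk_conv.
move=> t _; rewrite -EFinM lee_fin mulrCA.
have [xt|tx] := leP x t; first by rewrite (@rlk_eq0 _ q) ?mul0r// subr_le0.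
apply: ler_wpM2l; first exact: rlk_ge0.
rewrite rlk1; have [t0|t0] := leP t 0; first by rewrite rlk_eq0// mulr0.
rewrite mulr1 !rlkE// ler_wpM2r ?invr_ge0 ?(ltW (Gamma_gt0 p10))//.
by rewrite addrK ge0_ler_powR// ?nnegrE ltW.
Qed.

Lemma forcing_coef_rlk k x : 0 < x ->
  forcing_coef k * rlk (alpha * k%:R + 1) x = bk k * (x `^ alpha / alpha) ^+ k.
Proof.
move=> x0; rewrite rlkE// addrK powRrM powR_mulrn ?powR_ge0// /forcing_coef.
rewrite exprMn exprVn; field.
by rewrite expf_neq0 ?lt0r_neq0//= Gamma_gt0.
Qed.

(** Convergence of the power series in [t^alpha / alpha] at [t = x + 1] makes it absolutely
    convergent at [x]. By [rlk_addr_le] the shift of exponents by [q] multiplies its terms by at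
    most a constant. *)
Lemma is_cvg_forcing_series q x : 0 <= q ->
  cvgn (series (fun k => `|forcing_coef k| * rlk (alpha * k%:R + 1 + q) x)).
Proof.
move=> q0; have [x0|x0] := leP x 0.
  rewrite (_ : series _ = cst 0) ?is_cvg_cst//; first exact: is_cvg_cst.
  by apply/funext => n; rewrite /series/= big1// => k _; rewrite rlk_eq0// mulr0.
have cv : cvgn (series (fun k => `|bk k| * (x `^ alpha / alpha) ^+ k)).
  have x1 : 0 <= x + 1 by rewrite addr_ge0// ltW.
  apply: (@is_cvg_pseries_inside_norm _ bk ((x + 1) `^ alpha / alpha)).
    by apply/cvg_ex; exists (b (x + 1)); exact: hb.
  rewrite !ger0_norm ?divr_ge0 ?powR_ge0 ?ltW// ltr_pM2r ?invr_gt0//.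
  by rewrite gt0_ltr_powR ?nnegrE ?ltrDl// ltW.
have cvC C : cvgn (series (fun k => C * (`|bk k| * (x `^ alpha / alpha) ^+ k))).
  exact: is_cvg_seriesZ.
(* The case [q = 0] is separate because [rlk_addr_le] convolves with [rlk q], which requires
   [q > 0]. *)
pose C := if q == 0 then 1 else rlk (1 + q) x.
have C0 : 0 <= C.
  by rewrite /C; case: ifP => // _; rewrite rlk_ge0// ltr_pwDl.
have E k : `|forcing_coef k| * rlk (alpha * k%:R + 1) x =
    `|bk k| * (x `^ alpha / alpha) ^+ k.
  have := congr1 Num.norm (forcing_coef_rlk k x0).
  rewrite !normrM (ger0_norm (rlk_ge0 _ (p1_gt0 k))) => ->.
  by rewrite (ger0_norm (exprn_ge0 _ _))// divr_ge0 ?powR_ge0// ltW.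
apply: series_le_cvg (cvC C) => k.
- by rewrite mulr_ge0// rlk_ge0// ltr_pwDl// p1_gt0.
- by rewrite !mulr_ge0// exprn_ge0// divr_ge0 ?powR_ge0// ltW.
rewrite -E mulrCA ler_wpM2l// [C * _]mulrC /C.
have [->|q1] := eqVneq q 0; first by rewrite addr0/= mulr1.
rewrite /=; apply: rlk_addr_le => //; first by rewrite mulr_ge0// ltW.
by rewrite lt_def q1 q0.
Qed.

End coefficients.

(** * The brackets of the solution formula, their densities and their delayed sums *)

Section delay_solution.
Context {R : realType}.
Local Notation mu := (@lebesgue_measure R).
Variables (alpha : R) (bk : nat -> R) (b : R -> R).
Hypothesis halpha : 0 < alpha < 1.
Hypothesis hb : forall t : R, 0 <= t ->
  series (fun k : nat => bk k * (t `^ alpha / alpha) ^+ k) @ \oo --> b t.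

Local Notation forcing_coef := (forcing_coef alpha bk).

Let alpha0 : 0 < alpha. Proof. by case/andP: halpha. Qed.

Definition forcing_exp (j k : nat) : R := (j + k + 1)%:R * alpha.

Lemma forcing_exp_gt0 j k : 0 < forcing_exp j k.
Proof. by rewrite mulr_gt0// ltr0n addn1. Qed.

Lemma forcing_expE j k :
  forcing_exp j k + 1 = alpha * k%:R + 1 + j.+1%:R * alpha.
Proof. by rewrite /forcing_exp !natrD -natr1; ring. Qed.

(** Compared with [forcing_expE], adding [1 - alpha] in place of 1 turns [j.+1] into [j]: this is
    how the Caputo derivative lowers the index of a bracket. *)
Lemma forcing_exp_caputoE j k :
  forcing_exp j k + (1 - alpha) = alpha * k%:R + 1 + j%:R * alpha.
Proof. by rewrite /forcing_exp !natrD; ring. Qed.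

Lemma forcing_termE j x k : 0 <= x ->
  forcing_term alpha bk j x k = forcing_coef k * rlk (forcing_exp j k + 1) x.
Proof.
rewrite le_eqVlt => /predU1P[<-|x0].
  by rewrite rlk_eq0// mulr0 /forcing_term powR0 ?mul0r ?mulr0// lt0r_neq0// forcing_exp_gt0.
by rewrite rlkE// addrK.
Qed.

Definition forcing_part j x : R :=
  limn (series (fun k => forcing_coef k * rlk (forcing_exp j k + 1) x)).

Lemma forcing_part_cvg j x :
  cvgn (series (fun k => `|forcing_coef k| * rlk (forcing_exp j k + 1) x)).
Proof.
under eq_fun do rewrite forcing_expE.
by apply: (is_cvg_forcing_series halpha hb); rewrite mulr_ge0// ltW.
Qed.

Lemma is_cvg_forcing_term j x : 0 <= x -> cvgn (series (forcing_term alpha bk j x)).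
Proof.
move=> x0; apply: normed_cvg.
rewrite /normed_series_of /=; under eq_fun do rewrite forcing_termE// normrM.
under eq_fun do rewrite (ger0_norm (rlk_ge0 _ (addr_gt0 (forcing_exp_gt0 _ _) ltr01))).
exact: forcing_part_cvg.
Qed.

Lemma limn_series_eq0 (u : nat -> R) : (forall k, u k = 0) -> limn (series u) = 0.
Proof.
move=> u0; rewrite (_ : series u = cst 0) ?lim_cst//.
by apply/funext => n; rewrite /series/= big1.
Qed.

Lemma forcing_part_eq0 j x : x <= 0 -> forcing_part j x = 0.
Proof. by move=> x0; apply: limn_series_eq0 => k; rewrite rlk_eq0// mulr0. Qed.

Let h j := rlk_sum forcing_coef (forcing_exp j).

Lemma has_conv1_forcing j : has_conv 1 (h j) (forcing_part j).
Proof.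
apply: has_conv_rlk_sum => //; first exact: forcing_exp_gt0.
exact: forcing_part_cvg.
Qed.

Let has_conv_caputo j : has_conv (1 - alpha) (h j)
  (fun x => limn (series (fun k => forcing_coef k * rlk (forcing_exp j k + (1 - alpha)) x))).
Proof.
apply: has_conv_rlk_sum; first exact: forcing_exp_gt0.
  by rewrite subr_gt0; case/andP: halpha.
move=> x; under eq_fun do rewrite forcing_exp_caputoE.
by apply: (is_cvg_forcing_series halpha hb); rewrite mulr_ge0// ltW.
Qed.

Lemma has_conv_caputo_forcing0 :
  has_conv (1 - alpha) (h 0) (fun x => if 0 < x then b x else 0).
Proof.
apply: has_conv_ext (has_conv_caputo 0) => x; case: ifPn => [x0|].
  under eq_fun do rewrite forcing_exp_caputoE mul0r addr0 forcing_coef_rlk//.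
  by apply/cvg_lim => //; apply: hb; exact: ltW.
by rewrite -leNgt => x0; apply: limn_series_eq0 => k; rewrite rlk_eq0// mulr0.
Qed.

Lemma has_conv_caputo_forcingS j :
  has_conv (1 - alpha) (h j.+1) (forcing_part j).
Proof.
apply: has_conv_ext (has_conv_caputo j.+1) => x.
by under eq_fun do rewrite forcing_exp_caputoE -forcing_expE.
Qed.

Variables (a T y0 : R).
Hypothesis T0 : 0 < T.

Definition delay_term j x : R := y0 * rlk (alpha * j%:R + 1) x + forcing_part j x.

(** For [j = 0] the [y0] part of the bracket is [y0 * rlk 1], a jump at 0 without density. It is
    left out here and subtracted from the primitive in [has_conv1_delay]. *)
Definition delay_density j x : R :=
  (if j == 0%N then 0 else y0 * rlk (alpha * j%:R) x) + h j x.

Lemma delay_term_eq0 j x : x <= 0 -> delay_term j x = 0.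
Proof. by move=> x0; rewrite /delay_term rlk_eq0// forcing_part_eq0// mulr0 addr0. Qed.

Lemma delay_density_eq0 j x : x <= 0 -> delay_density j x = 0.
Proof.
move=> x0; rewrite /delay_density /h rlk_sum_eq0// addr0.
by case: ifP => // _; rewrite rlk_eq0// mulr0.
Qed.

Lemma measurable_delay_density j : measurable_fun setT (delay_density j).
Proof.
apply: measurable_funD; last by apply: measurable_rlk_sum; exact: forcing_exp_gt0.
case: (j == 0%N); first exact: measurable_cst.
by apply: measurable_funM => //; exact: measurable_rlk.
Qed.

Let aj_gt0 j : 0 < alpha * j.+1%:R. Proof. by rewrite mulr_gt0// ltr0n. Qed.

Lemma has_conv1_delay j : has_conv 1 (delay_density j)
  (fun x => delay_term j x - (if j == 0%N then y0 * rlk 1 x else 0)).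
Proof.
rewrite /delay_density /delay_term; case: j => [|j] /=.
  apply: has_conv_ext (has_convD (has_conv0 1) (has_conv1_forcing 0)) => x.
  by rewrite !(mulr0, add0r) addrAC subrr add0r.
apply: has_conv_ext (has_convD (has_convZ y0 (has_conv_rlk (aj_gt0 j) ltr01))
  (has_conv1_forcing j.+1)) => x.
by rewrite subr0.
Qed.

Lemma has_conv_caputo_delay0 :
  has_conv (1 - alpha) (delay_density 0) (fun x => if 0 < x then b x else 0).
Proof.
apply: has_conv_ext (has_convD (has_conv0 _) has_conv_caputo_forcing0) => x.
by rewrite add0r.
Qed.

Lemma has_conv_caputo_delayS j :
  has_conv (1 - alpha) (delay_density j.+1) (delay_term j).
Proof.
have a1 : 0 < 1 - alpha by rewrite subr_gt0; case/andP: halpha.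
apply: has_conv_ext (has_convD (has_convZ y0 (has_conv_rlk (aj_gt0 j) a1))
  (has_conv_caputo_forcingS j)) => x.
have -> : alpha * j.+1%:R + (1 - alpha) = alpha * j%:R + 1 by rewrite -natr1; ring.
by [].
Qed.

Definition delay_sum n t : R :=
  \sum_(0 <= j < n) (- a) ^+ j * delay_term j (t - j%:R * T).

Definition delay_sum_density n t : R :=
  \sum_(0 <= j < n) (- a) ^+ j * delay_density j (t - j%:R * T).

Lemma delay_sum_density_eq0 n t : t <= 0 -> delay_sum_density n t = 0.
Proof.
move=> t0; rewrite /delay_sum_density big1_seq// => j _.
by rewrite delay_density_eq0 ?mulr0// lerBlDr add0r (le_trans t0)// mulr_ge0// ltW.
Qed.

Lemma delay_sum_eq0 n t : t <= 0 -> delay_sum n t = 0.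
Proof.
move=> t0; rewrite /delay_sum big1_seq// => j _.
by rewrite delay_term_eq0 ?mulr0// lerBlDr add0r (le_trans t0)// mulr_ge0// ltW.
Qed.

Lemma measurable_delay_sum_density n : measurable_fun setT (delay_sum_density n).
Proof.
apply: measurable_sum => j; apply: measurable_funM => //.
by apply: (measurableT_comp (measurable_delay_density j)); exact: measurable_funB.
Qed.

Lemma has_conv1_delay_sum n : has_conv 1 (delay_sum_density n.+1)
  (fun t => delay_sum n.+1 t - y0 * rlk 1 t).
Proof.
have H j := has_convZ ((- a) ^+ j) (has_conv_shift (j%:R * T) (has_conv1_delay j)).
apply: has_conv_ext (has_conv_sum n.+1 H) => t.
under eq_bigr do rewrite mulrBr; rewrite sumrB; congr (_ - _).
rewrite big_nat_recl//= mul0r subr0 expr0 mul1r big1 ?addr0// => j _.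
by rewrite mulr0.
Qed.

(** Term 0 yields [b]; term [j.+1] yields [(-a)^(j+1)] times bracket [j] delayed by [(j+1) T].
    Factoring out [-a] and one delay [T] leaves the sum with one term fewer. *)
Lemma has_conv_caputo_delay_sum n : has_conv (1 - alpha) (delay_sum_density n.+1)
  (fun t => (if 0 < t then b t else 0) - a * delay_sum n (t - T)).
Proof.
pose G j := if j is i.+1 then delay_term i else fun x => if 0 < x then b x else 0.
have HG j : has_conv (1 - alpha) (delay_density j) (G j).
  case: j => [|j]; first exact: has_conv_caputo_delay0.
  exact: has_conv_caputo_delayS.
have H j := has_convZ ((- a) ^+ j) (has_conv_shift (j%:R * T) (HG j)).
apply: has_conv_ext (has_conv_sum n.+1 H) => t.
rewrite big_nat_recl//= mul0r subr0 expr0 mul1r /delay_sum mulr_sumr -sumrN.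
congr (_ + _); apply: eq_bigr => j _.
have -> : t - j.+1%:R * T = t - T - j%:R * T by rewrite -natr1; ring.
by rewrite exprS; ring.
Qed.

(** The brackets vanish at nonpositive times, which absorbs both the Heaviside factors and the
    truncation at the floor of [t / T]. At [t = 0] the two sides differ: there [0^0 = 1] produces
    [y0], while [rlk 1 0 = 0]. *)
Lemma delay_seriesE n t : t != 0 -> t < n%:R * T -> (0 < n)%N ->
  delay_series alpha a T y0 bk t = delay_sum n t.
Proof.
move=> t0 tn n0; rewrite /delay_series /delay_sum.
set m := (Num.truncn (t / T)).+1.
have termE j : (t - j%:R * T != 0) || (0 < j)%N ->
    (- a) ^+ j * heaviside (t - j%:R * T) *
    (y0 * ((t - j%:R * T) `^ (alpha * j%:R) / Gamma (alpha * j%:R + 1)) +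
     limn (series (forcing_term alpha bk j (t - j%:R * T)))) =
    (- a) ^+ j * delay_term j (t - j%:R * T).
  move: (t - _) => x xj; rewrite -mulrA; congr (_ * _); rewrite /heaviside.
  have [x0|x0] := leP 0 x; last by rewrite mul0r delay_term_eq0// ltW.
  rewrite mul1r /delay_term /forcing_part.
  have -> : forcing_term alpha bk j x =
      (fun k => forcing_coef k * rlk (forcing_exp j k + 1) x).
    by apply/funext => k; exact: forcing_termE.
  congr (y0 * _ + _); move: x0; rewrite le_eqVlt => /predU1P[x0|x0]; last first.
    by rewrite rlkE// addrK.
  move: xj; rewrite -x0 eqxx/= => j0.
  by rewrite rlk_eq0// powR0 ?mul0r// mulf_neq0 ?lt0r_neq0// ltr0n.
have E : \sum_(0 <= j < m) (- a) ^+ j * delay_term j (t - j%:R * T) =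
    \sum_(0 <= j < n) (- a) ^+ j * delay_term j (t - j%:R * T).
  have mn : (m <= n)%N.
    by rewrite /m -(prednK n0) ltnS truncn_le_nat prednK// ltr_pdivrMr.
  rewrite [RHS](big_cat_nat (leq0n m) mn)/= [X in _ + X]big1_seq ?addr0// => j.
  rewrite mem_index_iota => /andP[_ /andP[mj _]].
  rewrite delay_term_eq0 ?mulr0// subr_le0 -ler_pdivrMr//.
  by rewrite (le_trans (ltW (truncnS_gt _)))// ler_nat.
rewrite -E; apply: eq_big_nat => j _; apply: termE.
by case: j => [|j]; rewrite ?orbT// mul0r subr0 t0.
Qed.

End delay_solution.

(** * Existence and uniqueness for the delay equation *)

Section solution.
Context {R : realType}.
Local Notation mu := (@lebesgue_measure R).
Variables (alpha a T y0 : R) (bk : nat -> R) (b : R -> R).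
Hypothesis halpha : 0 < alpha < 1.
Hypothesis T0 : 0 < T.
Implicit Types (t x : R).
Hypothesis hb : forall t : R, 0 <= t ->
  series (fun k : nat => bk k * (t `^ alpha / alpha) ^+ k) @ \oo --> b t.

Let alpha0 : 0 < alpha. Proof. by case/andP: halpha. Qed.
Let alpha1 : 0 < 1 - alpha. Proof. by rewrite subr_gt0; case/andP: halpha. Qed.

Local Notation Y := (delay_series alpha a T y0 bk).
Local Notation hY := (delay_sum_density alpha bk a T y0).

Let time_bound (t : R) : exists2 n, (0 < n)%N & t < n%:R * T.
Proof.
exists (Num.truncn (t / T)).+1 => //.
by rewrite -ltr_pdivrMr// truncnS_gt.
Qed.

Lemma delay_series_causal : causal Y.
Proof.
move=> t t0; have [n n0 tn] := time_bound t.
by rewrite (delay_seriesE bk halpha a y0 T0 _ tn n0) ?lt_eqF// delay_sum_eq0// ltW.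
Qed.

Lemma delay_series0 : Y 0 = y0.
Proof.
rewrite /delay_series mul0r truncn0 big_nat1 expr0 mul1r mul0r subr0.
rewrite /heaviside lexx mul1r mulr0 powRr0 add0r Gamma1 divr1 mulr1.
rewrite limn_series_eq0 ?addr0// => k.
by rewrite forcing_termE// rlk_eq0// mulr0.
Qed.

Lemma delay_seriesI n t : (0 < n)%N -> 0 <= t -> t < n%:R * T ->
  Y t = y0 + \int[mu]_(s in `]-oo, t]) hY n s.
Proof.
move=> n0 t0 tn; have C := has_conv1_delay_sum halpha hb a T y0 n.-1.
rewrite prednK// in C.
rewrite -(has_conv1E (measurable_delay_sum_density bk halpha a T y0 n) C).
move: t0; rewrite le_eqVlt => /predU1P[<-|t0].
  by rewrite delay_series0 delay_sum_eq0// rlk_eq0//; ring.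
by rewrite (delay_seriesE bk halpha a y0 T0 _ tn n0) ?gt_eqF// rlk1 t0 mulr1 addrC subrK.
Qed.

Lemma integrable_hY n t : mu.-integrable `]-oo, t] (EFin \o hY n.+1).
Proof.
exact: has_conv1_integrable (has_conv1_delay_sum halpha hb a T y0 n) t.
Qed.

Lemma delay_series_abs_continuous : loc_abs_continuous Y.
Proof.
move=> r r0; have [n n0 rn] := time_bound r.
have ih t : mu.-integrable `]-oo, t] (EFin \o hY n).
  by rewrite -(prednK n0); exact: integrable_hY.
apply: (@eq_abs_continuous_on _ 0 r (fun t : R => y0 + \int[mu]_(s in `]-oo, t]) hY n s)).
  by move=> t /andP[t0 tr]; rewrite (delay_seriesI n0)// (le_lt_trans tr).
apply: abs_continuous_onD; first exact: abs_continuous_on_cst.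
have mh := measurable_delay_sum_density bk halpha a T y0 n.
exact: abs_continuous_indefinite_integral mh ih _ _.
Qed.

(** At [t = T] the delayed series has value [y0], whereas the delayed sum of kernels is 0; this is
    the exceptional point of the equation. *)
Lemma has_conv_caputo_delay_series n t : 0 < t -> t != T -> t < n.+1%:R * T ->
  mu.-integrable setT (fun s => (rlk (1 - alpha) (t - s) * hY n.+1 s)%:E) /\
  (\int[mu]_s (rlk (1 - alpha) (t - s) * hY n.+1 s)%:E = (b t - a * Y (t - T))%:E)%E.
Proof.
move=> t0 tT tn.
have [ih ->] := has_conv_caputo_delay_sum halpha hb a T y0 n t; split => //.
rewrite t0; congr (_ - a * _)%:E.
have tT' : t - T < n%:R * T by rewrite ltrBlDr -[X in _ + X]mul1r -mulrDl natr1.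
(* For [n = 0] the sum is empty and [t - T < 0], so causality replaces [delay_seriesE], which needs
   at least one term. *)
case: n {ih tn} tT' => [|n] tT'.
  rewrite /delay_sum big_nil; apply/esym/delay_series_causal.
  by move: tT'; rewrite mul0r.
by rewrite (delay_seriesE bk halpha a y0 T0 _ tT' (ltn0Sn n))// subr_eq0.
Qed.

Lemma ae_derive1_delay_series n :
  {ae mu, forall x, 0 < x < n.+1%:R * T -> Y^`()%classic x = hY n.+1 x}.
Proof.
have mh := measurable_delay_sum_density bk halpha a T y0 n.+1.
have := ae_derivable_indefinite_integral mh (integrable_hY n).
apply: (@filterS _ _ (ae_filter_ringOfSetsType mu)) => x [dH HE] xn.
pose H t := \int[mu]_(s in `]-oo, t]) hY n.+1 s.
have nearE : {near x, H \+ cst y0 =1 Y}.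
  have : x \in `]0, n.+1%:R * T[ by rewrite in_itv/= xn.
  move=> /near_in_itvoo; apply: filterS => t; rewrite in_itv/= => /andP[t0 tn].
  by rewrite /= addrC [RHS](delay_seriesI (ltn0Sn n) (ltW t0) tn).
by have [_ ->] := near_eq_derive1_addr nearE dH.
Qed.

Lemma delay_series_caputo t : 0 < t -> t != T -> caputo_delay_eq alpha a T b Y t.
Proof.
move=> t0 tT; have [[//|n] _ tn] := time_bound t.
have [ih hE] := has_conv_caputo_delay_series t0 tT tn.
rewrite /caputo_delay_eq; suff -> : caputo alpha Y t = b t - a * Y (t - T).
  by rewrite subrK.
apply: EFin_inj; rewrite -hE; apply: caputoE => //.
  by move=> u u0; exact: delay_sum_density_eq0.
have := ae_derive1_delay_series n.
apply: (@filterS _ _ (ae_filter_ringOfSetsType mu)) => x xE /andP[x0 xt].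
by apply: xE; rewrite x0 (lt_trans xt).
Qed.

Lemma delay_equation_unique (y : R -> R) : causal y -> loc_abs_continuous y ->
  y 0 = y0 ->
  {ae mu, forall t : R, 0 < t -> caputo_delay_eq alpha a T b y t} ->
  forall t : R, y t = Y t.
Proof.
move=> cy acy yy0 eqy t1; have [t10|t10] := ltP t1 0.
  by rewrite cy// delay_series_causal.
(* The margin 1 keeps [r] positive even for [t1 = 0], as the density lemma demands. *)
pose r := t1 + 1; have r0 : 0 < r by rewrite ltr_wpDl.
have [[//|n] _ rn] := time_bound r.
have [hy [mhy ihy hy0 yE dy]] := abs_continuous_density r0 (acy _ r0).
have mhY := measurable_delay_sum_density bk halpha a T y0 n.+1.
pose hz s := hy s - hY n.+1 s.
have mhz : measurable_fun setT hz by exact: measurable_funB.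
have ihyx (x : R) : mu.-integrable `]-oo, x] (EFin \o hy) by exact: integrableS ihy.
have ihz (x : R) : mu.-integrable `]-oo, x] (EFin \o hz).
  rewrite (_ : EFin \o hz = ((EFin \o hy) \- (EFin \o hY n.+1))%E); last first.
    by apply/funext => s; rewrite /hz /= EFinB.
  by apply: integrableB => //; exact: integrable_hY.
have zE (x : R) : 0 <= x <= r -> y x - Y x = \int[mu]_(s in `]-oo, x]) hz s.
  move=> /andP[x0 xr]; rewrite RintegralB//; last exact: integrable_hY.
  rewrite yE ?x0// yy0 (delay_seriesI (ltn0Sn n) x0 (le_lt_trans xr rn)).
  by rewrite opprD addrACA subrr add0r.
have hz0 s : s <= 0 -> hz s = 0.
  by move=> s0; rewrite /hz hy0 ?ltNge ?s0// delay_sum_density_eq0// subrr.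
suff H m (x : R) : 0 <= x <= r -> x <= m%:R * T -> y x = Y x.
  have [m _ tm] := time_bound t1.
  by apply: (H m) (ltW tm); rewrite t10 lerDl ler01.
elim: m x => [|m IH] x xr xm.
  suff -> : x = 0 by rewrite yy0 delay_series0.
  by apply/eqP; rewrite eq_le; case/andP: xr => -> _; rewrite andbT -[leRHS](mul0r T).
apply/eqP; rewrite -subr_eq0 zE//; apply/eqP.
have [ih hE] := has_conv1_indefinite_integral mhz ihz x.
(* Splitting [rlk 1] as the convolution of [rlk alpha] and [rlk (1 - alpha)] reduces the vanishing
   of the primitive of [hz] at [x] to that of [rlk (1 - alpha) * hz] almost everywhere before
   [x]. *)
have a1 : alpha + (1 - alpha) = 1 by rewrite addrC subrK.
apply: EFin_inj; rewrite -hE -[X in rlk X]a1; rewrite -[X in rlk X]a1 in ih.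
apply: (rlk_conv_conv_eq0 alpha0 alpha1 mhz ih).
move: (ae_integrable_rlk alpha0 alpha1 mhz ih) eqy (ae_neq T).
apply: (@filterS3 _ _ (ae_filter_ringOfSetsType mu)) => t it eqt tT tx.
have [t0|t0] := leP t 0.
  apply: integral0_eq => s _; have [ts|st] := leP t s.
    by rewrite rlk_eq0 ?mul0r// subr_le0.
  by rewrite hz0 ?mulr0// (le_trans (ltW st)).
have {}it := it tx; have {}eqt := eqt t0; have /andP[_ xr'] := xr.
have tr : t < r by exact: lt_le_trans xr'.
have [ihY YE] := has_conv_caputo_delay_series t0 tT (lt_trans tr rn).
have E : (fun s => (rlk (1 - alpha) (t - s) * hy s)%:E) =
    ((fun s => (rlk (1 - alpha) (t - s) * hz s)%:E) \+
     (fun s => (rlk (1 - alpha) (t - s) * hY n.+1 s)%:E))%E.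
  by apply/funext => s; rewrite /= -EFinD -mulrDr /hz subrK.
have ihyt : mu.-integrable setT (fun s => (rlk (1 - alpha) (t - s) * hy s)%:E).
  by rewrite E; exact: integrableD.
(* The delayed time is negative or at most [m T], so causality or the induction hypothesis
   applies. *)
have yYt : y (t - T) = Y (t - T).
  have [tT0|tT0] := ltP (t - T) 0; first by rewrite cy// delay_series_causal.
  apply: IH.
    by rewrite tT0 lerBlDr (le_trans (ltW tr))// lerDl ltW.
  by rewrite lerBlDr -[X in _ + X]mul1r -mulrDl natr1 (le_trans (ltW tx)).
have cyt : ((caputo alpha y t)%:E = \int[mu]_s (rlk (1 - alpha) (t - s) * hy s)%:E)%E.
  apply: caputoE => //; first by move=> u u0; rewrite hy0// ltNge u0.
  move: dy; apply: (@filterS _ _ (ae_filter_ringOfSetsType mu)) => u uE /andP[u0 ut].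
  by have [] := uE; rewrite ?u0 ?(lt_trans ut).
move: cyt; rewrite E integralD// YE.
have fin : (\int[mu]_s (rlk (1 - alpha) (t - s) * hz s)%:E)%E \is a fin_num.
  exact: integrable_fin_num.
rewrite -(fineK fin); move: (fine _) => w; rewrite -EFinD => wE; congr (_%:E).
(* With equal delayed terms, the equation for [y] reads [w + b t = b t]. *)
have := eqt; rewrite /caputo_delay_eq (EFin_inj wE) yYt -addrA subrK.
by move=> /eqP; rewrite -subr_eq0 addrK => /eqP.
Qed.

End solution.

(** Convergence of the inner series is a separate clause because [limn] is total and [delay_series]
    alone does not express it. *)
Theorem theorem7 (R : realType) (alpha a T y0 sigma : R)
    (b : R -> R) (bk : nat -> R)
    (halpha : 0 < alpha < 1) (ha : 0 < a) (hT : 0 < T)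
    (hb : forall t : R, 0 <= t ->
      series (fun k : nat => bk k * (t `^ alpha / alpha) ^+ k) @ \oo --> b t)
    (hsigma : forall s : R[i], complex.Re s = sigma ->
      `| a%:C%C * cexp (- s * T%:C%C) / cpow s alpha | < 1) :
  let Y := delay_series alpha a T y0 bk in
  [/\ forall (j : nat) (x : R), 0 <= x ->
        cvgn (series (forcing_term alpha bk j x)),
      [/\ causal Y, loc_abs_continuous Y, Y 0 = y0 &
          forall t : R, 0 < t -> t != T -> caputo_delay_eq alpha a T b Y t] &
      forall y : R -> R,
        causal y -> loc_abs_continuous y -> exponential_order y ->
        laplace_exists_on_line y sigma ->
        y 0 = y0 ->
        {ae lebesgue_measure, forall t : R, 0 < t ->
           caputo_delay_eq alpha a T b y t} ->
        forall t : R, y t = Y t].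
Proof.
move=> Y; split.
- by move=> j x x0; exact: (is_cvg_forcing_term halpha hb).
- split.
  + exact: delay_series_causal.
  + exact: (delay_series_abs_continuous a y0 halpha hT hb).
  + exact: delay_series0.
  + by move=> t t0 tT; exact: delay_series_caputo.
- by move=> y cy acy _ _ yy0 eqy; exact: (delay_equation_unique halpha hT hb cy acy yy0 eqy).
Qed.
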